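(* Infinitely many nontrivial uptori are of the form $m(u,s)$, where $u$ is a universal partial cycle for some $\mathcal{A}^x$ and $s$ is a De Bruijn cycle for $\{0,\ldots,|u|-1\}^y$ for some integer $y\ge 2$. In particular, for all even integers $a\ge 2$, all integers $y\ge 2$, and $x\in\{4,8\}$, there are at least $$\frac{\bigl((a^{x-1})!\bigr)^{a^{(x-1)(y-1)}}}{a^{(x-1)y}}$$ nontrivial uptori for $\{0,\ldots,a-1\}^{(y+1)\times x}$ of the form $m(u,s)$, where $u$ is a universal partial cycle for $\{0,\ldots,a-1\}^x$ and $s$ is a De Bruijn cycle for $\{0,\ldots,|u|-1\}^y$.
   Context: An alphabet $\mathcal{A}$ is a finite nonempty set, and $\diamond\notin\mathcal{A}$ is a wildcard symbol. A cyclic partial word over $\mathcal{A}$ is a cyclic sequence over $\mathcal{A}\cup\{\diamond\}$, indices being read modulo its length $|u|$. It covers a word $v$ at position $i$ if $v$ is obtained from the $|v|$ consecutive symbols starting at index $i$ (read cyclically) by replacing each $\diamond$ by some letter of $\mathcal{A}$ (independently for different places). A universal partial cycle (upcycle) for $\mathcal{A}^x$ is a cyclic partial word over $\mathcal{A}$ that covers every word in $\mathcal{A}^x$ exactly once, i.e. at exactly one position. A De Bruijn cycle for $\mathcal{B}^y$ is a cyclic word over $\mathcal{B}$ in which every word in $\mathcal{B}^y$ appears exactly once (rotations of a cyclic word are regarded as the same cyclic word). Fix linear representations $u=u_0\cdots u_{|u|-1}$ and $s=s_0\cdots s_{|s|-1}$ of the cyclic objects. Let $\sigma(c_0c_1\cdots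 c_{k-1})=c_1\cdots c_{k-1}c_0$ be forward rotation. Define $\phi_0=\sigma^{s_0}(u)$ and $\phi_n=\sigma^{s_n}(\phi_{n-1})$ for $1\le n\le |s|-1$. Then $m(u,s)$ is the $|s|\times|u|$ matrix with rows $\phi_0,\ldots,\phi_{|s|-1}$, considered cyclically in both directions. A partial torus over $\mathcal{A}$ is a matrix with entries in $\mathcal{A}\cup\{\diamond\}$ whose row and column indices are both read cyclically. It covers $P\in\mathcal{A}^{w\times\ell}$ (matrices over $\mathcal{A}$ with $w$ rows and $\ell$ columns) at position $(r,c)$ if $P$ is obtained from the $w\times\ell$ array of consecutive rows and columns (read cyclically) with top-left corner $(r,c)$ by replacing each $\diamond$ by some letter of $\mathcal{A}$. A universal partial torus (uptorus) for $\mathcal{A}^{w\times\ell}$ is a partial torus over $\mathcal{A}$ that covers every matrix in $\mathcal{A}^{w\times\ell}$ exactly once. It is trivial if it contains no $\diamond$, or all its entries are $\diamond$, or $w=1$ or $\ell=1$; otherwise it is nontrivial. *)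

(* Defs.v *)
From mathcomp Require Import all_boot all_order all_algebra.

Set Implicit Arguments.
Unset Strict Implicit.
Unset Printing Implicit Defensive.

Definition cshift (n : nat) (i : 'I_n) (k : nat) : 'I_n := iter k (@ordS n) i.

Definition cyc (B : Type) (s : seq B) (i : 'I_(size s)) (k : nat) : B :=
  tnth (in_tuple s) (cshift i k).

(* The symbols of a partial word or torus over A live in option A, with None
   for the wildcard. *)
Definition fits (A : eqType) (c : option A) (b : A) : bool :=
  (c == None) || (c == Some b).

Definition covers (A : finType) (x : nat) (u : seq (option A))
    (i : 'I_(size u)) (v : x.-tuple A) : Prop :=
  forall k : 'I_x, fits (cyc i k) (tnth v k).

Definition upcycle (A : finType) (x : nat) (u : seq (option A)) : Prop :=
  forall v : x.-tuple A, exists! i : 'I_(size u), covers i v.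

Definition debruijn (B : finType) (y : nat) (s : seq B) : Prop :=
  forall v : y.-tuple B,
    exists! i : 'I_(size s), forall k : 'I_y, cyc i k = tnth v k.

Record ptorus (A : Type) := PTorus {
  nrow : nat;
  ncol : nat;
  tmx :> 'M[option A]_(nrow, ncol)
}.

Definition torus_covers (A : finType) (w l : nat) (T : ptorus A)
    (r : 'I_(nrow T)) (c : 'I_(ncol T)) (P : 'M[A]_(w, l)) : Prop :=
  forall (i : 'I_w) (j : 'I_l), fits (T (cshift r i) (cshift c j)) (P i j).

Definition uptorus (A : finType) (w l : nat) (T : ptorus A) : Prop :=
  forall P : 'M[A]_(w, l),
    exists! p : 'I_(nrow T) * 'I_(ncol T), torus_covers p.1 p.2 P.

Definition trivial_torus (A : finType) (w l : nat) (T : ptorus A) : Prop :=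
  [\/ forall i j, T i j <> None, forall i j, T i j = None, w = 1 | l = 1].

Definition nontrivial_uptorus (A : finType) (w l : nat) (T : ptorus A) : Prop :=
  uptorus w l T /\ ~ trivial_torus w l T.

(* Since the indices of a torus are read cyclically, two matrices are the same
   torus when they differ by a translation. *)
Definition same_torus (A : Type) (T T' : ptorus A) : Prop :=
  exists (e : (nrow T = nrow T') * (ncol T = ncol T')) (r c : nat),
    forall i j, castmx e (tmx T) i j = T' (cshift i r) (cshift j c).

Definition relabel (A B : Type) (f : A -> B) (T : ptorus A) : ptorus B :=
  PTorus (map_mx (omap f) (tmx T)).

Definition rotation_rows (A : Type) (u : seq (option A))
    (s : seq 'I_(size u)) : seq (seq (option A)) :=
  scanl (fun phi (k : 'I_(size u)) => iter k (rot 1) phi) u s.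

(* The defaults of nth are never reached: there are size s rows, all of
   size size u. *)
Definition m_torus (A : Type) (u : seq (option A)) (s : seq 'I_(size u)) :
    ptorus A :=
  PTorus (\matrix_(i < size s, j < size u)
            nth None (nth [::] (rotation_rows s) i) j)%R.

Definition of_form_m (A : finType) (x y : nat) (T : ptorus A) : Prop :=
  exists (u : seq (option A)) (s : seq 'I_(size u)),
    [/\ upcycle x u, debruijn y s & T = m_torus s].

(* Main.v *)
Require Import Defs.
From mathcomp Require Import all_boot all_order all_algebra all_fingroup zify.

Set Implicit Arguments.
Unset Strict Implicit.
Unset Printing Implicit Defensive.

(** Let n be the length of the upcycle u and S_i = s_0 + ... + s_i.  Row i of
    m(u,s) is u rotated by S_i, so the window of m(u,s) at (r,c) fits a matrix P
    if and only if row t of P is covered by u at position S_(r+t) + c, for every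
    t <= y.  Since u is an upcycle, the positions p_0, ..., p_y of the rows of P
    are determined.  The condition thus says that the y consecutive letters of s
    after position r are the differences p_(t+1) - p_t modulo n, which happens
    for exactly one r as s is a De Bruijn cycle, and c is then p_0 - S_r.
    Reading across the last row is consistent because S modulo n has period |s|:
    every letter occurs n^(y-1) times in s, a multiple of n as y >= 2.  This is
    [uptorus_m_torus].  An upcycle has no period, so a translation between two of
    these tori forces the words s to be rotations of each other
    ([same_torus_rotation]).  It remains to count the De Bruijn cycles and to find
    an upcycle.

    Counting.  De Bruijn cycles of order k+1 are the Eulerian tours of the De
    Bruijn graph on words of length k.  Give every vertex a stack, that is, an
    order in which its outgoing edges will be used, and walk from a root.  If the
    last edges of the stacks form a tree directed to the root, then the walk uses
    every edge once ([withinP]) and the stacks can be read off it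
    ([tour_letters_inj]).  So the number of tours is the number of such trees
    times a product of factorials.  The trees are counted by a determinant
    ([matrix_tree]).  There is exactly one walk of length k between any two
    vertices, so the k-th power of the adjacency matrix A is the all-ones matrix
    J, hence A - (n/N) J is nilpotent, where N is the number of vertices, and
    det (nI - A + (n/N) J) = n^N.  Rank one updates turn this into the number of
    trees ([card_rooted_trees]).  Fixing the first letters of the tour picks one
    word out of each rotation class ([db_word_inj]).

    Upcycles.  For the binary alphabet there are upcycles for words of length 4
    and 8 with a wildcard at the end of every block of 4, respectively 8,
    symbols; they are checked by computation.  For an alphabet of 2M letters,
    seen as pairs of a bit and one of M colours, repeat the binary upcycle and
    colour its letters so that, at each place of the binary upcycle, the words of
    x-1 colours read there in the different repetitions are all different.  Such
    a colouring is an Eulerian tour of the De Bruijn graph times a cycle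
    ([nk_perfect]), given again by the stack walk, with the constant letter as
    last exits.  Then the bits of a word determine the place in the binary
    upcycle and the colours determine the repetition ([upcycle_mult]). *)

Import Order.TTheory GRing.Theory Num.Theory.

(** * Eulerian tours from stacks of exits *)

Section Tour.

Variables (V : finType) (m : nat) (step : V -> 'I_m.+1 -> V) (root : V).

Definition exit (f : V -> 'I_m.+1) (v : V) : V := step v (f v).

(** The edges chosen by f outside the root form a tree directed to the root. *)
Definition rooted (f : V -> 'I_m.+1) : bool :=
  [forall v, fconnect (exit f) v root].

(** The only way in which trees are used: following the chosen edges out of a
    set closed under them ends at the root. *)
Lemma rooted_closed f (W : {pred V}) v :
    rooted f -> {in W, forall w, w != root -> exit f w \in W} ->
  v \in W -> root \in W.
Proof.
move=> /forallP/(_ v)/connectP[q + + closedW].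
elim: q v => [|w q IHq] v /= => [_ -> //|/andP[/eqP <- pathq] lastq Wv].
have [<- // |v_root] := eqVneq v root.
exact: IHq pathq lastq (closedW v Wv v_root).
Qed.

Implicit Type p : {ffun V -> {perm 'I_m.+1}}.

(** At the root, which has no edge in the tree, the first exit is recorded
    instead; pinning it down will fix where the tour starts. *)
Definition last_exits p : {ffun V -> 'I_m.+1} :=
  [ffun v => p v (if v == root then ord0 else ord_max)].

(** The walk that leaves a vertex v at its j-th visit by the letter [p v j],
    together with the numbers of departures so far. *)
Fixpoint walk p (t : nat) : V * (V -> nat) :=
  if t is t'.+1 then
    let: (v, h) := walk p t' in
    (step v (p v (inord (h v))), fun w => h w + (v == w))
  else (root, fun=> 0).

Definition place p t := (walk p t).1.
Definition visits p t := (walk p t).2.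
Definition letter p t : 'I_m.+1 := p (place p t) (inord (visits p t (place p t))).

Lemma placeS p t : place p t.+1 = step (place p t) (letter p t).
Proof. by rewrite /letter /place /visits /=; case: (walk p t). Qed.

Lemma visitsS p t w : visits p t.+1 w = visits p t w + (place p t == w).
Proof. by rewrite /place /visits /=; case: (walk p t). Qed.

Definition entries p t w := \sum_(i < t) (place p i.+1 == w).

Lemma visits_sum p t w : visits p t w = \sum_(i < t) (place p i == w).
Proof. by elim: t => [|t IHt]; rewrite ?big_ord0 // visitsS big_ord_recr IHt. Qed.

(** Conservation: a vertex is entered as often as it is left, up to the two ends
    of the walk. *)
Lemma balance p t w :
  visits p t w + (place p t == w) = (root == w) + entries p t w.
Proof.
by rewrite -visitsS visits_sum big_ord_recl /= /entries; congr addn.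
Qed.

Lemma visits_mono p i j w : i <= j -> visits p i w <= visits p j w.
Proof.
move=> /subnK<-; elim: (j - i) => // d IHd.
by rewrite addSn visitsS (leq_trans IHd) ?leq_addr.
Qed.

(** No stack has been exhausted before step t. *)
Definition within p t := forall i, i < t -> visits p i (place p i) < m.+1.

Lemma edge_inj p t : within p t ->
  forall i j, i < t -> j < t ->
    place p i = place p j -> letter p i = letter p j -> i = j.
Proof.
move=> pt i j; wlog ltij : i j / i < j => [IH it jt Eij Lij|].
  by case: (ltngtP i j) => // /IH->.
move=> it jt Eij; rewrite /letter Eij => /perm_inj/(congr1 val).
have := pt i it; have := pt j jt; rewrite Eij => vj vi.
rewrite /= !inordK // => Ev; have := visits_mono p (place p j) ltij.
by rewrite visitsS Eij eqxx Ev addn1 ltnn.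
Qed.

Lemma visits_le p t w : within p t -> visits p t w <= m.+1.
Proof.
elim: t => [//|t IHt] pt; rewrite visitsS.
have [<-|_] := eqVneq; first by rewrite addn1 pt.
by rewrite addn0 IHt // => i it; apply: pt; rewrite ltnS ltnW.
Qed.

Hypothesis indeg :
  forall w, #|[set e : V * 'I_m.+1 | step e.1 e.2 == w]| <= m.+1.

Definition edge p i := (place p i, letter p i).

Lemma entries_card p t w (D := [set i : 'I_t | place p i.+1 == w]) :
  within p t -> entries p t w = #|[set edge p (i : 'I_t) | i in D]|.
Proof.
move=> pt; rewrite card_in_imset => [|i j _ _ [Eij Lij]].
  by rewrite /entries -sum1_card [RHS]big_mkcond; apply: eq_bigr => i _; rewrite inE.
exact/val_inj/(edge_inj pt (ltn_ord i) (ltn_ord j)).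
Qed.

Lemma entries_sub p t w (D := [set i : 'I_t | place p i.+1 == w]) :
  [set edge p (i : 'I_t) | i in D] \subset [set e | step e.1 e.2 == w].
Proof. by apply/subsetP => e /imsetP[i + ->]; rewrite !inE placeS. Qed.

Lemma entries_le p t w : within p t -> entries p t w <= m.+1.
Proof.
move=> pt; rewrite entries_card //.
exact: leq_trans (subset_leq_card (entries_sub _ _ _)) (indeg w).
Qed.

(** An edge that has not been used leaves its head with an entry to spare. *)
Lemma entries_lt p t e : within p t -> (forall i, i < t -> edge p i != e) ->
  entries p t (step e.1 e.2) < m.+1.
Proof.
move=> pt unused; rewrite entries_card //; apply: leq_trans (indeg (step e.1 e.2)).
apply: proper_card; rewrite properE entries_sub /=.
apply/subsetPn; exists e; first by rewrite inE.
by apply/imsetP => -[i _ /esym/eqP]; rewrite (negPf (unused i _)).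
Qed.

(** The walk cannot get stuck early.  If the stack is exhausted at the current
    vertex then, by conservation, that vertex is the root and all vertices are
    balanced.  A vertex with an unused exit has its last exit unused, so the head
    of that exit has an unused entry, hence an unused exit; following the tree
    this reaches the root, where nothing is left.  So all edges have been used. *)
Lemma withinP p : rooted (last_exits p) -> within p (#|V| * m.+1).
Proof.
move=> pT; suff: forall t, t <= #|V| * m.+1 -> within p t by apply.
elim=> [|t IHt] tE i; first by [].
rewrite ltnS leq_eqVlt => /predU1P[->{i}|]; last exact: (IHt (ltnW tE)).
have {IHt} pt := IHt (ltnW tE).
rewrite ltnNge; apply/negP=> full.
have := balance p t (place p t); rewrite eqxx addn1 => Bt.
have := entries_le (place p t) pt.
case: eqVneq Bt => [Er|_] Bt; last first.
  by rewrite add0n in Bt; rewrite -Bt ltnNge full.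
move=> _; have {Bt} full_root: visits p t root = m.+1.
  by apply/eqP; rewrite eqn_leq visits_le //= Er full.
have Bal w : visits p t w = entries p t w.
  by apply/eqP; rewrite -(eqn_add2r (root == w)) {1}Er balance addnC.
pose W := [pred w | visits p t w < m.+1].
have noW w : w \notin W.
  apply/negP=> Ww; suff: root \in W by rewrite inE full_root ltnn.
  apply: (rooted_closed pT _ Ww) => {w Ww} w; rewrite inE => Ww w_root.
  rewrite inE Bal /exit ffunE (negPf w_root).
  apply: (entries_lt (e := (w, _))) => //= i it.
  apply/eqP=> -[Ew]; rewrite /letter Ew => /perm_inj/(congr1 val)/=.
  have lt_iw: visits p i w < visits p t w.
    by have:= visits_mono p w it; rewrite visitsS Ew eqxx addn1.
  (* The last letter of the stack is used at the visit of number m only. *)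
  rewrite inordK ?(ltn_trans lt_iw) // => Em.
  by move: Ww; rewrite ltnS -Em leqNgt lt_iw.
have: \sum_w visits p t w = t.
  rewrite (eq_bigr _ (fun w _ => visits_sum p t w)) exchange_big /=.
  rewrite (eq_bigr (fun=> 1)) ?sum1_card ?card_ord // => i _.
  rewrite (bigD1 (place p i)) //= eqxx big1 ?addn0 // => w.
  by rewrite eq_sym => /negPf->.
rewrite (eq_bigr (fun=> m.+1)) => [|w _]; last first.
  by apply/eqP; have:= noW w; rewrite inE -leqNgt eqn_leq visits_le.
by rewrite sum_nat_const => Et; rewrite -Et ltnn in tE.
Qed.

Section Rooted.

Variable p : {ffun V -> {perm 'I_m.+1}}.
Hypothesis pT : rooted (last_exits p).

Lemma tour_inj i j : i < #|V| * m.+1 -> j < #|V| * m.+1 ->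
  edge p i = edge p j -> i = j.
Proof. by move=> iE jE [? ?]; apply: (edge_inj (withinP pT)). Qed.

Lemma tour_surj e : exists2 i, i < #|V| * m.+1 & edge p i = e.
Proof.
pose F (i : 'I_(#|V| * m.+1)) := edge p i.
have injF : injective F by move=> i j /tour_inj Eij; apply/val_inj/Eij.
have := inj_card_onto injF; rewrite card_prod !card_ord leqnn => /(_ isT e).
by case/codomP=> i ->; exists i.
Qed.

Lemma tour_closed : place p (#|V| * m.+1) = root.
Proof.
have full w : visits p (#|V| * m.+1) w = m.+1.
  apply/eqP; rewrite eqn_leq (visits_le _ (withinP pT)) /= visits_sum.
  pose D := [set i : 'I_(#|V| * m.+1) | place p i == w].
  have -> : \sum_(i < #|V| * m.+1) (place p i == w) = #|D|.
    by rewrite -sum1_card [RHS]big_mkcond; apply: eq_bigr => i _; rewrite inE.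
  apply: leq_trans (leq_imset_card (fun i : 'I_(#|V| * m.+1) => edge p i) _).
  have out : #|[set (w, c) | c : 'I_m.+1]| = m.+1.
    by rewrite card_imset ?card_ord // => c c' [].
  rewrite -[leqLHS]out; apply/subset_leq_card/subsetP => e /imsetP[c _ ->].
  have [i iE Ei] := tour_surj (w, c).
  apply/imsetP; exists (Ordinal iE) => //; rewrite inE /=.
  by case: Ei => ->.
set w := place p _; have := balance p (#|V| * m.+1) w.
have [<- // | _] := eqVneq root w.
rewrite full eqxx add0n addn1 => full_entries.
by have := entries_le w (withinP pT); rewrite -full_entries ltnn.
Qed.

End Rooted.

(** The j-th letter used at v is [p v j], so the sequence of letters determines
    the walk, hence the visit counts, hence the stacks. *)
Lemma tour_letters_inj p p' :
    rooted (last_exits p) -> rooted (last_exits p') ->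
    (forall i, i < #|V| * m.+1 -> letter p i = letter p' i) ->
  p = p'.
Proof.
move=> pT p'T Epp'.
have Ep i : i <= #|V| * m.+1 -> place p i = place p' i.
  elim: i => // i IHi iE; rewrite !placeS IHi 1?ltnW //.
  by rewrite Epp'.
have Ev i w : i <= #|V| * m.+1 -> visits p i w = visits p' i w.
  move=> iE; rewrite !visits_sum; apply: eq_bigr => j _.
  by rewrite Ep // ltnW // (leq_trans _ iE).
apply/ffunP=> v; apply/permP=> j.
have [i iE [Ei]] := tour_surj pT (v, p v j).
have := Epp' i iE; rewrite /letter -Ep 1?ltnW // -Ev 1?ltnW // Ei => E /perm_inj Ej.
by move: E; rewrite Ej.
Qed.

Lemma letter0 p : letter p 0 = p root ord0.
Proof. by rewrite /letter /=; congr (p root _); apply/val_inj; rewrite /= inordK. Qed.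

End Tour.

(** * Counting trees with a determinant *)

Local Open Scope ring_scope.

(** Two block triangular factorisations of the same matrix. *)
Lemma det_rank1_update (R : comPzRingType) n (u : 'cV[R]_n) (v : 'rV[R]_n) :
  \det (1%:M + u *m v) = 1 + (v *m u) 0 0.
Proof.
have /(congr1 determinant) :
    block_mx (1%:M : 'M[R]_1) 0 u 1%:M *m block_mx 1%:M (- v) 0 (1%:M + u *m v)
    = block_mx (1%:M + v *m u) (- v) 0 1%:M *m block_mx 1%:M 0 u 1%:M.
  rewrite !mulmx_block !mul1mx !mulmx1 !mul0mx !mulmx0 !mulNmx !mulmxN.
  by rewrite !addr0 !add0r addrK [- _ + _]addrC addrK.
rewrite !det_mulmx !det_lblock !det_ublock !det1 !mul1r !mulr1 => ->.
by rewrite det_mx11 !mxE.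
Qed.

(** The geometric factorisation of X^k - B^k shows that the characteristic
    polynomial of B divides a power of X. *)
Lemma det_sub_nilpotent (F : fieldType) n k (B : 'M[F]_n.+1) x :
  B ^+ k = 0 -> \det (x%:M - B) = x ^+ n.+1.
Proof.
move=> Bk0; pose B' := map_mx polyC B; pose X : 'M[{poly F}]_n.+1 := 'X%:M.
have Bk'0 : B' ^+ k = 0 by rewrite -rmorphXn Bk0 rmorph0.
have cXB : GRing.comm X B' by apply/esym; exact: scalar_mxC.
have dvdB : char_poly B %| ('X - 0%:P) ^+ (n.+1 * k).
  have := subrXX_comm k cXB; rewrite Bk'0 subr0 -rmorphXn /= => /(congr1 determinant).
  by rewrite det_scalar subr0 -exprM mulnC => ->; rewrite det_mulmx dvdp_mulr.
have [j _] := dvdp_exp_XsubCP dvdB.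
rewrite eqp_monic ?char_poly_monic ?monic_exp ?monicXsubC // subr0 => /eqP chB.
have /eqP := size_char_poly B; rewrite chB size_polyXn eqSS => /eqP Ej.
have -> : x ^+ n.+1 = (char_poly B).[x] by rewrite chB Ej hornerXn.
rewrite horner_sum; apply: eq_bigr => s _.
rewrite hornerM horner_exp !hornerE; congr (_ * _).
rewrite (big_morph _ (fun p q => hornerM p q x) (hornerC 1 x)).
by apply: eq_bigr => i _; rewrite !mxE !(hornerE, hornerMn).
Qed.

Section Trees.

Variables (N m : nat).
Notation V := 'I_N.+1.
Notation L := 'I_m.+1.
Variables (step : V -> L -> V) (root : V).

(** The root has a single choice, so that each tree is counted once. *)
Definition choices (v : V) : pred L := fun c => (v == root) ==> (c == ord0).

Definition tree_mx (f : {ffun V -> L}) : 'M[rat]_N.+1 :=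
  \matrix_(v, w) ((v == w)%:R - ((v != root) && (exit step f v == w))%:R).

(** In the Leibniz expansion, a permutation other than the identity contributes
    only if it moves vertices along chosen edges.  The vertices that it moves are
    then closed under these edges, so a tree would make it move the root. *)
Lemma det_tree_mx_rooted (f : {ffun V -> L}) :
  rooted step root f -> \det (tree_mx f) = 1.
Proof.
move=> fT; rewrite /determinant (bigD1 1%g) //= odd_perm1 expr0 mul1r.
rewrite (big1 _ (fun s : 'S_N.+1 => s != 1%g)) ?addr0 => [|s s1].
  rewrite big1 // => v _; rewrite perm1 !mxE eqxx.
  have [|v_root /=] := eqVneq v root; first by rewrite subr0.
  have [Ev|_] := eqVneq (exit step f v) v; last by rewrite subr0.
  suff: root \in pred1 v by rewrite inE eq_sym (negPf v_root).
  apply: (rooted_closed fT _ (v := v)); last exact: eqxx.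
  by move=> w /eqP-> _; rewrite Ev inE.
have [/forallP nz|] := boolP [forall v, tree_mx f v (s v) != 0]; last first.
  rewrite negb_forall => /existsP[v]; rewrite negbK => /eqP Mv.
  by rewrite (bigD1 v) //= Mv mul0r mulr0.
have exitE v : s v != v -> v != root /\ exit step f v = s v.
  move=> /negPf svv; move: (nz v); rewrite mxE [v == s v]eq_sym svv sub0r oppr_eq0.
  by case: andP => [[-> /eqP]|] //; rewrite eqxx.
have [v sv] : exists v, s v != v.
  apply/existsP; apply: contraR s1; rewrite negb_exists => /forallP s1.
  by apply/eqP/permP=> v; rewrite perm1; apply/eqP; have := s1 v; rewrite negbK.
suff: root \in [pred v | s v != v] by rewrite inE => /exitE[]; rewrite eqxx.
apply: (rooted_closed fT _ sv) => w; rewrite !inE => sw _; have [_ ->] := exitE w sw.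
by apply: contra sw => /eqP/perm_inj->.
Qed.

(** The indicator of the vertices that do not reach the root is in the kernel. *)
Lemma det_tree_mx_unrooted (f : {ffun V -> L}) :
  ~~ rooted step root f -> \det (tree_mx f) = 0.
Proof.
rewrite negb_forall => /existsP[v0 lost].
apply/eqP; rewrite -det_tr; apply/det0P.
pose far v := ~~ fconnect (exit step f) v root.
exists (\row_v (far v)%:R).
  by apply/eqP => /rowP/(_ v0)/eqP; rewrite !mxE /far lost oner_eq0.
apply/rowP=> v; rewrite !mxE.
under eq_bigr do rewrite !mxE mulrBr.
rewrite sumrB (bigD1 v) //= eqxx mulr1 big1 ?addr0 => [|w]; last first.
  by rewrite eq_sym => /negPf->; rewrite mulr0.
rewrite (bigD1 (exit step f v)) //= eqxx andbT big1 ?addr0 => [|w]; last first.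
  by rewrite eq_sym => /negPf->; rewrite andbF mulr0.
have [->|v_root] := eqVneq v root; first by rewrite /far connect0 mulr0 subr0.
rewrite mulr1; apply/eqP; rewrite subr_eq0; apply/eqP; congr (~~ _)%:R.
apply/idP/idP => [/connectP[[|w q] /=]|]; first by move=> _ E; rewrite E eqxx in v_root.
  case/andP=> /eqP E pathq ->; apply/connectP; exists q => //; first by rewrite E.
  by rewrite E.
by apply: connect_trans; apply: fconnect1.
Qed.

Definition arcs (v w : V) : rat := \sum_c (step v c == w)%:R.

(** The Laplacian with the row of the root replaced by a unit vector. *)
Definition reduced_mx : 'M[rat]_N.+1 :=
  \matrix_(v, w) if v == root then (v == w)%:R else (v == w)%:R *+ m.+1 - arcs v w.

(** Each row of [reduced_mx] is the sum over the choices at its vertex of the rows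
    of the matrices [tree_mx]; the determinant expands accordingly. *)
Lemma matrix_tree :
  \det reduced_mx =
    #|[set f : {ffun V -> L} | (f root == ord0) && rooted step root f]|%:R.
Proof.
have redE v w : reduced_mx v w = \sum_(c | choices v c)
    ((v == w)%:R - ((v != root) && (step v c == w))%:R).
  rewrite mxE /choices; case: (v == root) => /=.
    by rewrite big_pred1_eq subr0.
  by rewrite sumrB sumr_const card_ord.
transitivity (\sum_(f in family choices) \det (tree_mx f)).
  rewrite /determinant exchange_big /=; apply: eq_bigr => s _.
  rewrite -big_distrr /=; congr (_ * _).
  under eq_bigr do rewrite redE.
  rewrite bigA_distr_big_dep; apply: eq_bigr => f _.
  by apply: eq_bigr => v _; rewrite mxE.
have famE (f : {ffun V -> L}) : (f \in family choices) = (f root == ord0).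
  apply/familyP/idP => [/(_ root)|f0 v]; rewrite /in_mem /= /choices ?eqxx //.
  by apply/implyP=> /eqP->.
rewrite (eq_bigl _ _ famE) -sum1_card natr_sum.
rewrite big_mkcond [RHS]big_mkcond; apply: eq_bigr => f _; rewrite inE.
case: (f root == ord0) => //=.
by case: ifP => [/det_tree_mx_rooted | /negbT/det_tree_mx_unrooted].
Qed.

Hypothesis indegrees : forall w, \sum_v arcs v w = m.+1%:R.

Definition laplacian : 'M[rat]_N.+1 :=
  \matrix_(v, w) ((v == w)%:R *+ m.+1 - arcs v w).

Lemma laplacian_row v : \sum_w laplacian v w = 0.
Proof.
under eq_bigr do rewrite mxE.
rewrite sumrB sumrMnl (bigD1 v) //= eqxx big1 ?addr0 => [|w]; last first.
  by rewrite eq_sym => /negPf->.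
rewrite exchange_big /= (eq_bigr (fun=> 1)) ?sumr_const ?card_ord ?subrr // => c _.
rewrite (bigD1 (step v c)) //= eqxx big1 ?addr0 // => w.
by rewrite eq_sym => /negPf->.
Qed.

Lemma laplacian_col w : \sum_v laplacian v w = 0.
Proof.
under eq_bigr do rewrite mxE.
rewrite sumrB sumrMnl (bigD1 w) //= eqxx big1 ?addr0 => [|v /negPf->] //.
by rewrite indegrees subrr.
Qed.

(** The rows and columns of the Laplacian sum to zero.  So adding all rows of
    the left hand matrix to that of the root, by U, turns that row into a
    multiple of the all-ones row.  The columns of the reduced matrix
    sum to the unit column of the root, so adding this sum to the columns other
    than that of the root, by Z, turns the row of the root into the all-ones
    row; W then adjusts the rows by multiples of that one. *)
Lemma det_laplacianD c :
  \det (laplacian + const_mx c) = c * N.+1%:R ^+ 2 * \det reduced_mx.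
Proof.
pose e : 'rV[rat]_N.+1 := delta_mx 0 root.
pose one : 'rV[rat]_N.+1 := const_mx 1.
pose w : 'cV[rat]_N.+1 := \col_v (if v == root then c * N.+1%:R - 1 else c).
pose U := 1%:M + e^T *m (one - e).
pose W := 1%:M + w *m e.
pose Z := 1%:M + one^T *m (one - e).
have eE n (A : 'M[rat]_(N.+1, n)) x : (e *m A) 0 x = A root x by rewrite -rowE mxE.
have oneE n (A : 'M[rat]_(N.+1, n)) x : (one *m A) 0 x = \sum_y A y x.
  by rewrite mxE; apply: eq_bigr => y _; rewrite mxE mul1r.
have subE n (A : 'M[rat]_(N.+1, n)) x :
    ((one - e) *m A) 0 x = \sum_y A y x - A root x.
  by rewrite mulmxBl mxE [X in _ + X]mxE eE oneE.
have rowU (A : 'M[rat]_N.+1) v x :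
    (U *m A) v x = if v == root then \sum_y A y x else A v x.
  rewrite mulmxDl mul1mx -mulmxA mxE [X in _ + X]mxE big_ord1 subE !mxE eqxx /=.
  have [->|_] := eqVneq v root; last by rewrite mul0r addr0.
  by rewrite mul1r addrC subrK.
have rowW (A : 'M[rat]_N.+1) v x : (W *m A) v x = A v x + w v 0 * A root x.
  by rewrite mulmxDl mul1mx -mulmxA mxE [X in _ + X]mxE big_ord1 eE.
have colZ (A : 'M[rat]_N.+1) v x :
    (A *m Z) v x = A v x + (\sum_y A v y) * (1 - (x == root)%:R).
  rewrite mulmxDr mulmx1 mulmxA mxE [X in _ + X]mxE big_ord1 !mxE eqxx /=.
  by congr (_ + _ * _); apply: eq_bigr => y _; rewrite !mxE mulr1.
have UWZ : U *m (laplacian + const_mx c) = W *m (reduced_mx *m Z).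
  apply/matrixP=> v x; rewrite rowU rowW !colZ.
  have red_root :
      reduced_mx root x + (\sum_y reduced_mx root y) * (1 - (x == root)%:R) = 1.
    rewrite mxE eqxx (bigD1 root) //= mxE !eqxx big1 => [|y]; last first.
      by rewrite mxE eqxx eq_sym => /negPf->.
    by rewrite addr0 mul1r eq_sym addrC subrK.
  rewrite red_root mulr1 [w v 0]mxE; have [->|/negPf v_root] := eqVneq v root.
    rewrite red_root [RHS]addrC subrK; under eq_bigr do rewrite mxE.
    rewrite big_split /= laplacian_col add0r; under eq_bigr do rewrite mxE.
    by rewrite sumr_const card_ord mulr_natr.
  have red_lap y : reduced_mx v y = laplacian v y by rewrite !mxE v_root.
  rewrite (eq_bigr _ (fun y _ => red_lap y)) laplacian_row mul0r addr0 red_lap.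
  by rewrite !mxE.
have detU : \det U = 1.
  rewrite det_rank1_update subE !mxE !eqxx (bigD1 root) //=.
  rewrite big1 => [|y /negPf y_root]; last by rewrite !mxE y_root.
  by rewrite !mxE !eqxx.
have detW : \det W = c * N.+1%:R.
  by rewrite det_rank1_update eE !mxE eqxx addrC subrK.
have detZ : \det Z = N.+1%:R.
  rewrite det_rank1_update subE !mxE.
  under eq_bigr do rewrite !mxE.
  by rewrite sumr_const card_ord addrC subrK.
have detUM A : \det A = \det (U *m A) by rewrite det_mulmx detU mul1r.
rewrite detUM UWZ !det_mulmx detW detZ.
by rewrite expr2 !mulrA mulrAC.
Qed.

End Trees.

Section UniqueWalks.

Variables (N m k : nat) (step : 'I_N.+1 -> 'I_m.+1 -> 'I_N.+1) (root : 'I_N.+1).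

Definition adjacency : 'M[rat]_N.+1 := \matrix_(v, w) arcs step v w.

Hypothesis unique_walks : adjacency ^+ k = const_mx 1.

Lemma mulmx_ones (A : 'M[rat]_N.+1) v w : (A * const_mx 1) v w = \sum_x A v x.
Proof. by rewrite mxE; apply: eq_bigr => x _; rewrite mxE mulr1. Qed.

Lemma adjacency_ones : adjacency * const_mx 1 = const_mx m.+1%:R.
Proof.
apply/matrixP=> v w; rewrite mulmx_ones mxE; under eq_bigr do rewrite mxE.
rewrite exchange_big /= (eq_bigr (fun=> 1)) ?sumr_const ?card_ord // => c _.
rewrite (bigD1 (step v c)) //= eqxx big1 ?addr0 // => x.
by rewrite eq_sym => /negPf->.
Qed.

(** A commutes with its power J, so JA = AJ has constant entries too. *)
Lemma arcs_in w : \sum_v arcs step v w = m.+1%:R.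
Proof.
have : const_mx 1 * adjacency = const_mx m.+1%:R.
  by rewrite -adjacency_ones -unique_walks -exprSr -exprS.
move=> /matrixP/(_ w w); rewrite !mxE => <-.
by apply: eq_bigr => v _; rewrite !mxE mul1r.
Qed.

(** B = A - (m.+1 / N.+1) J satisfies BJ = 0, since the rows of A sum to m.+1.
    So B^(j+1) = B A^j, which vanishes for j = k.  The characteristic polynomial
    of B at m.+1 is the determinant of the Laplacian plus a constant matrix. *)
Theorem card_rooted_trees :
  (#|[set f : {ffun 'I_N.+1 -> 'I_m.+1} | (f root == ord0) && rooted step root f]|
     * N.+1 = m.+1 ^ N)%N.
Proof.
pose t : rat := m.+1%:R / N.+1%:R; pose B := adjacency - const_mx t.
have N0 : N.+1%:R != 0 :> rat by rewrite pnatr_eq0.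
have BJ : B * const_mx 1 = 0.
  rewrite mulrBl adjacency_ones; apply/matrixP=> v w.
  rewrite mxE [X in _ + X]mxE mulmx_ones [RHS]mxE mxE; under eq_bigr do rewrite mxE.
  by rewrite sumr_const card_ord -[t *+ _]mulr_natr divfK ?subrr.
have BX j : B ^+ j.+1 = B * adjacency ^+ j.
  elim: j => [|j IHj]; first by rewrite mulr1.
  have BJt : B * const_mx t = 0.
    have -> : const_mx t = t *: const_mx 1 :> 'M[rat]_N.+1.
      by apply/matrixP=> v w; rewrite !mxE mulr1.
    by rewrite -scalerAr BJ scaler0.
  rewrite exprSr {2}/B mulrBr {2}exprSr -[in X in _ - X]mulrA BJt mulr0 subr0.
  by rewrite IHj -mulrA -exprSr.
have BN : B ^+ k.+1 = 0 by rewrite BX unique_walks BJ.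
have := det_sub_nilpotent m.+1%:R BN.
have -> : m.+1%:R%:M - B = laplacian step + const_mx t.
  by apply/matrixP=> v w; rewrite !mxE opprB [t - _]addrC addrA mulrnAC.
rewrite (det_laplacianD root arcs_in).
have m0 : m.+1%:R != 0 :> rat by rewrite pnatr_eq0.
rewrite matrix_tree expr2 !mulrA divfK // -mulrA -natrM exprS => /(mulfI m0) E.
by apply/eqP; rewrite -(eqr_nat rat) natrX -E mulnC.
Qed.

End UniqueWalks.

Local Close Scope ring_scope.

Section Transport.

Variables (V : finType) (N m : nat) (step : V -> 'I_m.+1 -> V) (root : V).
Variables (e : V -> 'I_N.+1) (e' : 'I_N.+1 -> V).
Hypotheses (eK : cancel e e') (e'K : cancel e' e).

(** Matrices are indexed by ordinals, so the graph is moved to one. *)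
Definition tstep (i : 'I_N.+1) (c : 'I_m.+1) := e (step (e' i) c).

Lemma rooted_transport f :
  rooted tstep (e root) [ffun i => f (e' i)] = rooted step root f.
Proof.
have iterE j v :
    iter j (exit tstep [ffun i => f (e' i)]) (e v) = e (iter j (exit step f) v).
  by elim: j => //= j ->; rewrite /exit /tstep ffunE eK.
apply/forallP/forallP => [fT v|fT i]; last rewrite -[i]e'K.
  have /iter_findex := fT (e v); rewrite iterE => /(can_inj eK) <-.
  exact: fconnect_iter.
by have /iter_findex <- := fT (e' i); rewrite -iterE; apply: fconnect_iter.
Qed.

Lemma card_rooted_transport :
  #|[set f : {ffun 'I_N.+1 -> 'I_m.+1} |
        (f (e root) == ord0) && rooted tstep (e root) f]|
  = #|[set f : {ffun V -> 'I_m.+1} | (f root == ord0) && rooted step root f]|.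
Proof.
pose F (f : {ffun V -> 'I_m.+1}) : {ffun 'I_N.+1 -> 'I_m.+1} := [ffun i => f (e' i)].
have injF : injective F.
  by move=> f g /ffunP Efg; apply/ffunP=> v; have := Efg (e v); rewrite !ffunE eK.
rewrite -(card_imset _ injF); apply: eq_card => f; rewrite inE.
have [{f}g ->] : exists g, f = F g :> {ffun 'I_N.+1 -> 'I_m.+1}.
  by exists [ffun v => f (e v)]; apply/ffunP=> i; rewrite !ffunE e'K.
by rewrite rooted_transport ffunE eK mem_imset // inE.
Qed.

End Transport.

Lemma card_perm_at m (i j : 'I_m.+1) :
  #|[set s : {perm 'I_m.+1} | s i == j]| = m`!.
Proof.
pose A j := [set s : {perm 'I_m.+1} | s i == j].
have cA j' : #|A j'| = #|A j|.
  rewrite -(card_imset (A j) (mulIg (tperm j j'))).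
  apply: eq_card => s; rewrite inE.
  apply/idP/imsetP => [/eqP si|[s' + ->]].
    exists (s * tperm j j')%g; first by rewrite inE permM si tpermR.
    by rewrite -mulgA tperm2 mulg1.
  by rewrite inE permM => /eqP->; rewrite tpermL.
apply/eqP; rewrite -(eqn_pmul2l (ltn0Sn m)) -factS -(card_Sn m.+1); apply/eqP.
transitivity (\sum_j' #|A j'|).
  by rewrite (eq_bigr _ (fun j' _ => cA j')) sum_nat_const card_ord.
rewrite -sum1_card (partition_big (fun s : {perm 'I_m.+1} => s i) predT) //=.
by apply: eq_bigr => j' _; rewrite -sum1_card; apply: eq_bigl => s; rewrite inE.
Qed.

(** Once the letter at one end of the stack of a vertex is fixed, the others may
    be in any order. *)
Lemma card_rooted_stacks (V : finType) m (step : V -> 'I_m.+1 -> V) root :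
  #|[set p : {ffun V -> {perm 'I_m.+1}} |
      (p root ord0 == ord0) && rooted step root (last_exits root p)]|
  = #|[set f : {ffun V -> 'I_m.+1} | (f root == ord0) && rooted step root f]|
    * m`! ^ #|V|.
Proof.
set S := [set p | _]; set T := [set f | _].
rewrite -sum1_card (partition_big (last_exits root) (mem T)) => [|p] /=; last first.
  by rewrite !inE ffunE eqxx.
rewrite -sum_nat_const; apply: eq_bigr => f fT.
pose F v :=
  [pred s : {perm 'I_m.+1} | s (if v == root then ord0 else ord_max) == f v].
transitivity #|family F|.
  rewrite -sum1_card; apply: eq_bigl => p; apply/andP/familyP.
    by move=> [_ /eqP Ep] v; rewrite inE -Ep ffunE.
  move=> pF; have Ep : last_exits root p = f.
    by apply/ffunP=> v; have := pF v; rewrite inE ffunE => /eqP.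
  split; last exact/eqP.
  by move: fT; rewrite -Ep !inE ffunE eqxx.
rewrite card_family /image_mem [in RHS]cardE.
elim: (enum V) => //= v s ->; rewrite expnS; congr (_ * _).
rewrite -[RHS](card_perm_at (if v == root then ord0 else ord_max) (f v)).
by rewrite cardsE.
Qed.

(** * Tours read cyclically *)

Lemma cshiftE n (i : 'I_n) k : val (cshift i k) = (i + k) %% n.
Proof.
rewrite /cshift; elim: k => [|k IHk] /=; first by rewrite addn0 modn_small.
by rewrite IHk -addn1 modnDml addn1 addnS.
Qed.

Lemma cycE (B : Type) (s : seq B) x0 (i : 'I_(size s)) k :
  cyc i k = nth x0 s ((i + k) %% size s).
Proof. by rewrite /cyc (tnth_nth x0) /= cshiftE. Qed.

Section CyclicTour.

Variables (V : finType) (m : nat) (step : V -> 'I_m.+1 -> V) (root : V).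
Hypothesis indeg :
  forall w, #|[set e : V * 'I_m.+1 | step e.1 e.2 == w]| <= m.+1.

Let E := #|V| * m.+1.

Lemma tour_length_gt0 : 0 < E.
Proof. by rewrite muln_gt0 andbT; apply/card_gt0P; exists root. Qed.

Implicit Type p : {ffun V -> {perm 'I_m.+1}}.

Definition cplace p t := place step root p (t %% E).
Definition cletter p t := letter step root p (t %% E).

Lemma cplaceS p t : rooted step root (last_exits root p) ->
  cplace p t.+1 = step (cplace p t) (cletter p t).
Proof.
move=> pT; rewrite /cplace /cletter -placeS -addn1 -modnDml addn1.
have := ltn_pmod t tour_length_gt0; rewrite leq_eqVlt => /predU1P[->|/modn_small-> //].
by rewrite modnn tour_closed.
Qed.

Lemma cedge_surj p k e : rooted step root (last_exits root p) ->
  exists2 i, i < E & (cplace p (i + k), cletter p (i + k)) = e.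
Proof.
move=> pT; have [t tE Et] := tour_surj indeg pT e.
exists ((t + k * E.-1) %% E); first exact/ltn_pmod/tour_length_gt0.
rewrite /cplace /cletter modnDml -addnA -mulnSr prednK ?tour_length_gt0 //.
by rewrite addnC modnMDl modn_small.
Qed.

Lemma cedge_inj p k i j : rooted step root (last_exits root p) ->
    cplace p (i + k) = cplace p (j + k) -> cletter p (i + k) = cletter p (j + k) ->
  i = j %[mod E].
Proof.
move=> pT Ep Ec; apply/eqP; rewrite -(eqn_modDr k); apply/eqP.
apply: (tour_inj indeg pT); rewrite ?ltn_pmod ?tour_length_gt0 //.
by rewrite /edge -/(cplace _ _) Ep; congr pair.
Qed.

(** [h] maps the graph to a De Bruijn graph, so that the vertices of the tour
    record the last k letters. *)
Variables (k : nat) (h : V -> k.-tuple 'I_m.+1).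
Hypothesis hS : forall v c, h (step v c) = rcons (behead (h v)) c :> seq _.

Lemma window p t : rooted step root (last_exits root p) ->
  h (cplace p (t + k)) = [tuple cletter p (t + j) | j < k].
Proof.
move=> pT; apply/val_inj => /=.
suff W i : i <= k ->
    drop (k - i) (h (cplace p (t + i))) = mkseq (fun j => cletter p (t + j)) i.
  have := W k (leqnn k); rewrite subnn drop0 => ->.
  by rewrite /mkseq -val_enum_ord -map_comp.
elim: i => [|i IHi] ik; first by rewrite subn0 drop_oversize ?size_tuple.
rewrite addnS cplaceS // hS mkseqS -IHi ?(ltnW ik) //.
have sk : k - i = (k - i.+1).+1 by rewrite -subSn.
rewrite drop_rcons ?size_behead ?size_tuple; last first.
  by rewrite -ltnS -sk prednK ?leq_subr ?(leq_trans _ ik).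
by congr rcons; rewrite sk -drop1 drop_drop addn1.
Qed.

End CyclicTour.

(** * De Bruijn cycles *)

Section DeBruijn.

Variables (m k : nat).
Notation L := 'I_m.+1.
Notation V := (k.+1.-tuple L).

Definition db_step (v : V) (c : L) : V := rcons_tuple (behead_tuple v) c.
Definition db_root : V := nseq_tuple k.+1 ord0.

(** An edge into w is determined by the letter that it drops. *)
Lemma db_indeg w : #|[set e : V * L | db_step e.1 e.2 == w]| <= m.+1.
Proof.
rewrite -[leqRHS](card_ord m.+1).
pose head (e : V * L) := thead e.1; apply: (leq_card_in head) => -[v c] [v' c'].
rewrite !inE /= => /eqP <- /eqP/(congr1 val)/= /rcons_inj[Eb ->] Eh.
congr pair; apply/val_inj; rewrite (tuple_eta v) (tuple_eta v') /=.
by rewrite -[thead v]/(head (v, c)) Eh Eb.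
Qed.

Lemma card_db_vertices : #|{: V}| = m.+1 ^ k.+1.
Proof. by rewrite card_tuple card_ord. Qed.

(** A walk of length j from v leads to w if and only if v without its first j
    letters is a prefix of w, and is then spelled by the rest of w. *)
Lemma db_unique_walks N (e : V -> 'I_N.+1) (e' : 'I_N.+1 -> V) :
    cancel e e' -> cancel e' e ->
  (adjacency (tstep db_step e e') ^+ k.+1 = const_mx 1)%R.
Proof.
move=> eK e'K; pose A := adjacency (tstep db_step e e').
suff AX j i i' : j <= k.+1 ->
    ((A ^+ j) i i' = (drop j (e' i) == take (k.+1 - j) (e' i') :> seq L)%:R)%R.
  apply/matrixP=> i i'; rewrite AX // !mxE subnn take0 drop_oversize ?eqxx //.
  by rewrite size_tuple.
elim: j i i' => [|j IHj] i i' jk.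
  rewrite drop0 subn0 take_oversize ?size_tuple // mxE.
  by rewrite -(can_eq e'K) -val_eqE.
rewrite exprS mxE; under eq_bigr do rewrite mxE IHj ?(ltnW jk) // mulr_suml.
rewrite exchange_big /=.
have step1 c : (\sum_x (tstep db_step e e' i c == x)%:R *
     (drop j (e' x) == take (k.+1 - j) (e' i') :> seq L)%:R)%R
   = ((c == tnth (e' i') (inord (k - j))) &&
        (drop j.+1 (e' i) == take (k.+1 - j.+1) (e' i') :> seq L))%:R%R :> rat.
  rewrite (bigD1 (tstep db_step e e' i c)) //= eqxx mul1r big1 ?addr0 => [|x]; last first.
    by rewrite eq_sym => /negPf->; rewrite mul0r.
  rewrite /tstep eK /= subSn // subSS.
  rewrite drop_rcons ?size_behead ?size_tuple // -drop1 drop_drop addn1.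
  rewrite (take_nth ord0) ?size_tuple ?ltnS ?leq_subr //.
  by rewrite eqseq_rcons andbC (tnth_nth ord0) inordK // ltnS leq_subr.
under eq_bigr do rewrite step1.
rewrite (bigD1 (tnth (e' i') (inord (k - j)))) //= eqxx big1 ?addr0 //.
by move=> c /negPf->.
Qed.

Lemma card_db_trees :
  #|[set f : {ffun V -> L} | (f db_root == ord0) && rooted db_step db_root f]|
    * m.+1 ^ k.+1 = m.+1 ^ (m.+1 ^ k.+1).-1.
Proof.
have [N EN] : exists N, m.+1 ^ k.+1 = N.+1.
  by exists (m.+1 ^ k.+1).-1; rewrite prednK // expn_gt0.
have EV := etrans card_db_vertices EN.
pose e (v : V) := cast_ord EV (enum_rank v).
pose e' i : V := enum_val (cast_ord (esym EV) i).
have e'K : cancel e' e by move=> i; rewrite /e /e' enum_valK cast_ordKV.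
have eK : cancel e e' by move=> v; rewrite /e /e' cast_ordK enum_rankK.
rewrite -(card_rooted_transport _ _ eK e'K) EN.
exact: card_rooted_trees (db_unique_walks eK e'K).
Qed.

Definition db_stacks := [set p : {ffun V -> {perm L}} |
  (p db_root ord0 == ord0) && rooted db_step db_root (last_exits db_root p)].

Lemma card_db_stacks :
  #|db_stacks| * m.+1 ^ k.+2 = m.+1`! ^ (m.+1 ^ k.+1).
Proof.
rewrite card_rooted_stacks card_db_vertices; set T := #|_|; set M := m.+1 ^ k.+1.
have nM : m.+1 ^ M = m.+1 * (T * M).
  by rewrite card_db_trees -expnS prednK // expn_gt0.
by rewrite factS expnMn nM expnS mulnAC [T * _]mulnCA.
Qed.

Definition db_word (p : {ffun V -> {perm L}}) : seq L :=
  mkseq (letter db_step db_root p) (m.+1 ^ k.+2).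

Section Word.

Variable p : {ffun V -> {perm L}}.
Hypothesis pT : rooted db_step db_root (last_exits db_root p).

Lemma db_word_nth i :
  nth ord0 (db_word p) (i %% m.+1 ^ k.+2) = cletter db_step db_root p i.
Proof.
rewrite nth_mkseq ?ltn_pmod ?expn_gt0 //.
by rewrite /cletter card_db_vertices -expnSr.
Qed.

Lemma db_window t :
  cplace db_step db_root p (t + k.+1)
    = [tuple cletter db_step db_root p (t + j) | j < k.+1].
Proof. exact: (window db_indeg (h := id)). Qed.

Lemma debruijn_db_word : debruijn k.+2 (db_word p).
Proof.
have sz : size (db_word p) = m.+1 ^ k.+2 by rewrite size_mkseq.
have szE : #|{: V}| * m.+1 = m.+1 ^ k.+2 by rewrite card_db_vertices -expnSr.
move=> v; pose w : V := [tuple tnth v (widen_ord (leqnSn _) j) | j < k.+1].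
have readP (i : 'I_(size (db_word p))) : (forall j : 'I_k.+2, cyc i j = tnth v j) <->
    cplace db_step db_root p (i + k.+1) = w /\
    cletter db_step db_root p (i + k.+1) = tnth v ord_max.
  have cycE' j : cyc i j = cletter db_step db_root p (i + j).
    by rewrite (cycE ord0) -db_word_nth; congr (nth _ _ (_ %% _)).
  rewrite db_window; split=> [iv|[Ew Ec] j].
    split; last by rewrite -cycE' -(iv ord_max).
    by apply: eq_from_tnth => j; rewrite !tnth_mktuple -cycE' -iv.
  rewrite cycE'; have [jk|kj] := ltnP j k.+1.
    have := congr1 (fun u => tnth u (Ordinal jk)) Ew; rewrite !tnth_mktuple => ->.
    by congr (tnth v _); apply/val_inj.
  suff -> : j = ord_max by [].
  by apply/val_inj/eqP; rewrite /= eqn_leq kj -ltnS ltn_ord.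
have [i iE [Ei1 Ei2]] := cedge_surj db_indeg k.+1 (w, tnth v ord_max) pT.
rewrite szE -sz in iE; exists (Ordinal iE); split=> [|i' /readP[Ei'1 Ei'2]].
  exact/readP.
have := cedge_inj db_indeg pT (etrans Ei1 (esym Ei'1)) (etrans Ei2 (esym Ei'2)).
rewrite !modn_small ?szE -?sz //.
by move=> Eii'; apply/val_inj.
Qed.

(** Each letter is used once at each vertex, and the number of vertices is a
    multiple of the number of letters. *)
Lemma db_word_sum : m.+1 %| \sum_(c <- db_word p) (c : nat).
Proof.
have szE : #|{: V}| * m.+1 = m.+1 ^ k.+2 by rewrite card_db_vertices -expnSr.
rewrite big_map -{1}[m.+1 ^ k.+2]subn0 -[iota 0 _]/(index_iota 0 _) big_mkord -szE.
pose F (i : 'I_(#|{: V}| * m.+1)) := edge db_step db_root p i.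
have injF : injective F.
  by move=> i j Eij; apply/val_inj/(tour_inj db_indeg pT) => //; apply: ltn_ord.
have [F' FK F'K] : bijective F by apply: inj_card_bij injF _; rewrite card_prod !card_ord.
have -> : \sum_(i < #|{: V}| * m.+1) (letter db_step db_root p i : nat)
    = \sum_(e : V * L) (e.2 : nat).
  by rewrite [RHS](reindex F) //=; exists F' => ? _; rewrite ?FK ?F'K.
rewrite -(pair_bigA _ (fun (_ : V) (c : L) => c : nat)) /= sum_nat_const.
by rewrite card_db_vertices expnS -mulnA dvdn_mulr.
Qed.

End Word.

(** A word in the family has the root followed by the letter 0 ending at its
    first letter, and nowhere else.  So a rotation between two words of the family
    is trivial. *)
Lemma db_word_inj p p' r : p \in db_stacks -> p' \in db_stacks ->
    (forall i, nth ord0 (db_word p) (i %% m.+1 ^ k.+2)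
             = nth ord0 (db_word p') ((i + r) %% m.+1 ^ k.+2)) ->
  p = p'.
Proof.
rewrite !inE => /andP[/eqP p0 pT] /andP[/eqP p'0 p'T] Epp'.
have szE : #|{: V}| * m.+1 = m.+1 ^ k.+2 by rewrite card_db_vertices -expnSr.
have {}Epp' i :
    cletter db_step db_root p i = cletter db_step db_root p' (i + r).
  by rewrite -!db_word_nth.
have E_gt0 := tour_length_gt0 m db_root.
(* i is -(k+1) modulo the length, so that the window at i ends at letter 0. *)
pose i := k.+1 * (#|{: V}| * m.+1).-1.
have ik : (i + k.+1) %% (#|{: V}| * m.+1) = 0.
  by rewrite /i addnC -mulnS prednK // modnMl.
have start q : cletter db_step db_root q (i + k.+1) = q db_root ord0.
  by rewrite /cletter ik letter0.
have /eqP : i + r = i %[mod #|{: V}| * m.+1].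
  apply: (cedge_inj (k := k.+1) db_indeg p'T); last first.
    by rewrite start p'0 addnAC -Epp' start p0.
  have -> : cplace db_step db_root p' (i + k.+1)
      = cplace db_step db_root p (i + k.+1).
    by rewrite /cplace ik.
  rewrite !db_window //; apply: eq_from_tnth => j.
  by rewrite !tnth_mktuple addnAC -Epp'.
rewrite -{2}[i]addn0 eqn_modDl mod0n => /eqP r0.
apply: (tour_letters_inj db_indeg pT p'T) => t tE.
by have := Epp' t; rewrite /cletter -modnDmr r0 addn0 modn_small.
Qed.

End DeBruijn.

(** * Colourings: words with all windows in each residue class *)

Section Necklace.

Variables (m k q : nat).
Notation L := 'I_m.+1.
Notation V := (k.+1.-tuple L * 'I_q.+1)%type.

(** De Bruijn graph times a cycle: the vertices of a tour also record the time
    modulo q.+1. *)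
Definition nk_step (v : V) (c : L) : V := (db_step v.1 c, ordS v.2).
Definition nk_root : V := (db_root m k, ord0).

Lemma nk_indeg w : #|[set e : V * L | nk_step e.1 e.2 == w]| <= m.+1.
Proof.
rewrite -[leqRHS](card_ord m.+1).
pose head (e : V * L) := thead e.1.1.
apply: (leq_card_in head) => -[[v i] c] [[v' i'] c'].
rewrite !inE /= => /eqP <- /eqP[/rcons_inj[Eb ->] Ei] Eh.
congr (_, _, _); last by apply: (can_inj (@ordSK _)); apply/val_inj.
apply/val_inj; rewrite (tuple_eta v) (tuple_eta v') /=.
by rewrite -[thead v]/(head (v, i, c)) Eh Eb.
Qed.

(** The identity at the root and, elsewhere, a permutation with the letter 0
    last: all recorded exits append a 0. *)
Definition nk_stack : {ffun V -> {perm L}} :=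
  [ffun v => if v == nk_root then 1%g else tperm ord0 ord_max].

(** Appending zeros leads to the zero word, and then around the cycle. *)
Lemma nk_rooted : rooted nk_step nk_root (last_exits nk_root nk_stack).
Proof.
set f := last_exits _ _; have f0 v : f v = ord0.
  by rewrite !ffunE; case: eqP => _; rewrite ?perm1 ?tpermR.
have iterE v i j : iter i (exit nk_step f) (v, j)
   = (iter i (fun w => db_step w ord0) v, iter i (@ordS _) j).
  by elim: i => //= i ->; rewrite /exit f0.
have zeros i (v : k.+1.-tuple L) : i <= k.+1 ->
    iter i (fun w => db_step w ord0) v = drop i v ++ nseq i ord0 :> seq L.
  elim: i => [|i IHi] ik; first by rewrite drop0 cats0.
  rewrite iterS /= IHi ?(ltnW ik) // (drop_nth ord0) ?size_tuple //= rcons_cat.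
  by rewrite -cats1 -(nseqD i 1) addn1.
have zeros' (v : k.+1.-tuple L) i : k.+1 <= i ->
    iter i (fun w => db_step w ord0) v = db_root m k.
  move=> /subnK <-; elim: (i - k.+1) => [|j IHj].
    by rewrite add0n; apply/val_inj; rewrite [LHS]zeros // drop_oversize ?size_tuple.
  rewrite addSn iterS IHj; apply/val_inj => /=.
  by rewrite -cats1 -(nseqD k 1) addn1.
apply/forallP=> -[v j]; pose i := k.+1 * q.+1 + (q.+1 - j).
suff -> : nk_root = iter i (exit nk_step f) (v, j) by apply: fconnect_iter.
rewrite iterE zeros' ?(leq_trans _ (leq_addr _ _)) ?leq_pmulr //.
congr pair; apply/val_inj; rewrite -[iter _ _ _]/(cshift j i) cshiftE /i.
by rewrite addnCA subnKC 1?ltnW // modnMDl modnn.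
Qed.

Definition nk_letter (t : nat) : L := cletter nk_step nk_root nk_stack t.

Lemma nk_period : #|{: V}| * m.+1 = q.+1 * m.+1 ^ k.+2.
Proof. by rewrite card_prod card_tuple !card_ord mulnAC -expnSr mulnC. Qed.

Lemma nk_letter_mod t : nk_letter (t %% (q.+1 * m.+1 ^ k.+2)) = nk_letter t.
Proof. by rewrite /nk_letter /cletter nk_period modn_mod. Qed.

Lemma nk_phase t : val (cplace nk_step nk_root nk_stack t).2 = t %% q.+1.
Proof.
elim: t => [|t IHt]; first by rewrite /cplace mod0n mod0n.
rewrite (cplaceS nk_indeg) ?nk_rooted //= IHt.
by rewrite -addn1 modnDml addn1.
Qed.

Lemma nk_window t w : (forall j : 'I_k.+2, nk_letter (t + j) = tnth w j) <->
  (cplace nk_step nk_root nk_stack (t + k.+1)).1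
      = [tuple tnth w (widen_ord (leqnSn _) j) | j < k.+1]
    /\ nk_letter (t + k.+1) = tnth w ord_max.
Proof.
rewrite (window nk_indeg (h := fst) _ _ nk_rooted) //.
split=> [tw|[Ew Ec] j].
  split; last by rewrite -(tw ord_max).
  by apply: eq_from_tnth => j; rewrite !tnth_mktuple -tw.
have [jk|kj] := ltnP j k.+1.
  have := congr1 (fun u => tnth u (Ordinal jk)) Ew; rewrite !tnth_mktuple /= => Ej.
  by rewrite /nk_letter Ej; congr (tnth w _); apply/val_inj.
suff -> : j = ord_max by [].
by apply/val_inj/eqP; rewrite /= eqn_leq kj -ltnS ltn_ord.
Qed.

(** The edges of the graph are the pairs of a word of length k.+2 and a residue
    modulo q.+1, and the tour uses each of them once. *)
Lemma nk_perfect g (w : k.+2.-tuple L) :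
  exists! t : 'I_(m.+1 ^ k.+2),
    forall j : 'I_k.+2, nk_letter (g + t * q.+1 + j) = tnth w j.
Proof.
set B := m.+1 ^ k.+2; set w' := [tuple tnth w (widen_ord (leqnSn _) j) | j < k.+1].
have B_gt0 : 0 < B by rewrite expn_gt0.
have [i iE [Ei Ec]] := cedge_surj nk_indeg k.+1
  ((w', Ordinal (ltn_pmod (g + k.+1) (ltn0Sn q))), tnth w ord_max) nk_rooted.
have ig : i = g %[mod q.+1].
  by apply/eqP; rewrite -(eqn_modDr k.+1) -!nk_phase Ei nk_phase.
have gE : g <= i + g * (q.+1 * B).
  by rewrite (leq_trans _ (leq_addl _ _)) // leq_pmulr // muln_gt0.
(* The multiple of the period is added to keep the difference nonnegative. *)
pose t := ((i + g * (q.+1 * B) - g) %/ q.+1) %% B.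
have dvd_q : q.+1 %| i + g * (q.+1 * B) - g.
  by rewrite -eqn_mod_dvd // mulnCA -modnDmr modnMr addn0 ig.
have tq : t * q.+1 = (i + g * (q.+1 * B) - g) %% (q.+1 * B).
  by rewrite /t mulnC muln_modr [q.+1 * (_ %/ _)]mulnC divnK.
have Et : g + t * q.+1 = i %[mod q.+1 * B].
  by rewrite tq modnDmr subnKC // addnC modnMDl.
have tB : t < B by rewrite ltn_pmod.
clearbody t.
have windowE s : (forall j : 'I_k.+2, nk_letter (s + j) = tnth w j) ->
    s = g %[mod q.+1] -> s = i %[mod q.+1 * B].
  move=> /nk_window[Ew El] Es; rewrite -nk_period.
  apply: (cedge_inj (k := k.+1) nk_indeg nk_rooted); last by rewrite Ec -El.
  rewrite Ei; case: (cplace _ _ _ _) Ew (nk_phase (s + k.+1)) => /= x y -> Ey.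
  by congr pair; apply/val_inj; rewrite [LHS]Ey /= -modnDml Es modnDml.
exists (Ordinal tB); split=> [j /=|t' /windowE Et'].
  rewrite -nk_letter_mod -modnDml Et modnDml nk_letter_mod.
  move: j; apply/nk_window; split; last by rewrite -Ec.
  by rewrite Ei.
apply/val_inj/eqP => /=.
rewrite -(modn_small tB) -[X in _ == X](modn_small (ltn_ord t')).
rewrite -(eqn_pmul2l (ltn0Sn q)) !muln_modr [q.+1 * t]mulnC [q.+1 * t']mulnC.
by rewrite -(eqn_modDl g) Et Et' // addnC modnMDl.
Qed.

End Necklace.

(** * Upcycles over even alphabets *)

Section AlphabetMultiplier.

Variables (k m : nat) (A : finType).
Let d := k.+2.
Let x := d.+1.
Variables (glue : bool * 'I_m.+1 -> A) (split : A -> bool * 'I_m.+1).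
Hypotheses (glueK : cancel glue split) (splitK : cancel split glue).
Variable u : seq (option bool).
Hypothesis u_up : upcycle x u.
Hypothesis size_u : x %| size u.
(** Each window of length x then contains exactly one wildcard. *)
Hypothesis u_wild : forall i, i < size u -> (nth None u i == None) = (i %% x == d).

Let Q := size u.
Let q := d * (Q %/ x).
Let B := m.+1 ^ d.

Lemma u_gt0 : 0 < Q.
Proof. by have [i _] := u_up [tuple false | _ < x]; case: i; rewrite -/Q; case: Q. Qed.

Lemma q_gt0 : 0 < q.
Proof. by rewrite muln_gt0 /= divn_gt0 // dvdn_leq // u_gt0. Qed.

(** The number of places before P that are not wildcards. *)
Definition rank (P : nat) := d * (P %/ x) + P %% x.

Lemma rankD P j : rank (j * x + P) = j * d + rank P.
Proof. by rewrite /rank divnMDl // modnMDl mulnDr mulnC addnA. Qed.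

(** The window of length x at P has its wildcard at d - P %% x; skipping it leaves
    d consecutive letters. *)
Lemma rank_bump P l : l < d -> rank (P + bump (d - P %% x) l) = rank P + l.
Proof.
move=> ld; have rx : P %% x < x by rewrite ltn_mod.
rewrite {1 3}(divn_eq P x) -addnA !rankD -addnA; congr (_ + _).
rewrite /rank (divn_small rx) (modn_small rx) muln0 add0n.
move: (P %% x) rx => r; rewrite ltnS => rd; rewrite /bump.
have [dl|dl] := leqP (d - r) l; last first.
  have rlx : r + (0 + l) < x by rewrite /x; lia.
  by rewrite divn_small // modn_small // muln0.
have -> : r + (1 + l) = 1 * x + (r + l - d) by rewrite /x; lia.
have rlx : r + l - d < x by rewrite /x; lia.
by rewrite divnMDl // modnMDl divn_small // modn_small // muln1; lia.
Qed.

Definition colour (P : nat) : 'I_m.+1 := nk_letter m k q.-1 (rank P).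

Definition mult_sym (P : nat) : option A :=
  omap (fun b => glue (b, colour P)) (nth None u (P %% Q)).

Definition mult_word : seq (option A) := mkseq mult_sym (Q * B).

Lemma mult_sym_mod P : mult_sym (P %% (Q * B)) = mult_sym P.
Proof.
rewrite /mult_sym modn_dvdm ?dvdn_mulr //; congr omap.
suff -> : colour (P %% (Q * B)) = colour P by [].
have PE : P = P %/ (Q * B) * B * (Q %/ x) * x + P %% (Q * B).
  by rewrite -mulnA (divnK size_u) -mulnA [B * _]mulnC -divn_eq.
rewrite /colour {2}PE rankD.
rewrite -[LHS]nk_letter_mod -[RHS]nk_letter_mod prednK ?q_gt0 //.
have -> : P %/ (Q * B) * B * (Q %/ x) * d = P %/ (Q * B) * (q * B).
  by rewrite /q; lia.
by rewrite modnMDl.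
Qed.

Lemma size_mult_word : size mult_word = Q * B.
Proof. by rewrite size_mkseq. Qed.

Lemma covers_mult (i : 'I_(size mult_word)) (v : x.-tuple A) :
  covers i v <-> forall j : 'I_x, fits (mult_sym (i + j)) (tnth v j).
Proof.
have E (j : 'I_x) : cyc i j = mult_sym (i + j).
  rewrite (cycE None) -[RHS]mult_sym_mod nth_mkseq.
    by congr (mult_sym (_ %% _)); apply: size_mult_word.
  by rewrite -[X in _ < X]size_mult_word ltn_pmod // (leq_trans _ (ltn_ord i)).
by split=> cov j; have := cov j; rewrite E.
Qed.

Lemma fits_mult P c : fits (mult_sym P) c =
  fits (nth None u (P %% Q)) (split c).1
    && ((nth None u (P %% Q) == None) || (colour P == (split c).2)).
Proof.
rewrite /fits /mult_sym; case: nth => [b|] //=.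
rewrite -[c]splitK; case: (split c) => b' i; rewrite glueK /=.
rewrite -[Some _ == _]/(glue (b, colour P) == glue (b', i)) (can_eq glueK).
by [].
Qed.

Lemma wild_at P j : j < x ->
  (nth None u ((P + j) %% Q) == None) = (j == d - P %% x).
Proof.
move=> jx; rewrite u_wild ?ltn_pmod ?u_gt0 // modn_dvdm // -modnDml.
have := ltn_pmod P (ltn0Sn d); rewrite -/x; move: (P %% x) => r rx.
rewrite /x in jx rx *.
have [rj|rj] := ltnP (r + j) d.+1; first by rewrite modn_small //; lia.
have -> : r + j = 1 * d.+1 + (r + j - d.+1) by lia.
rewrite modnMDl modn_small; lia.
Qed.

Lemma mult_window P (v : x.-tuple A) (e := inord (d - P %% x) : 'I_x) :
  (forall j : 'I_x, fits (mult_sym (P + j)) (tnth v j)) <->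
  (forall j : 'I_x, fits (nth None u ((P + j) %% Q)) (split (tnth v j)).1) /\
  (forall l : 'I_d, nk_letter m k q.-1 (rank P + l) = (split (tnth v (lift e l))).2).
Proof.
have eE : e = d - P %% x :> nat by rewrite inordK // ltnS leq_subr.
have colourE (l : 'I_d) : colour (P + lift e l) = nk_letter m k q.-1 (rank P + l).
  by rewrite /colour /= eE rank_bump.
split=> [cov|[cov1 cov2] j]; last first.
  rewrite fits_mult cov1 wild_at // -eE; case: (unliftP e j) => [l|] ->.
    by rewrite colourE cov2 eqxx orbT.
  by rewrite eqxx.
split=> [j|l]; first by have := cov j; rewrite fits_mult => /andP[].
have := cov (lift e l); rewrite fits_mult => /andP[_].
rewrite wild_at // -eE val_eqE eq_sym (negPf (neq_lift _ _)) /= colourE.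
by move=> /eqP.
Qed.

(** The bits of v determine the place i0 in u.  The place determines where the
    wildcard falls, hence which d colours of v must be matched, and these
    determine the repetition t of u. *)
Lemma upcycle_mult : upcycle x mult_word.
Proof.
move=> v; pose b := [tuple (split (tnth v j)).1 | j < x].
have baseE (i : 'I_Q) : covers i b <->
    forall j : 'I_x, fits (nth None u ((i + j) %% Q)) (split (tnth v j)).1.
  have E (j : 'I_x) : fits (cyc i j) (tnth b j)
      = fits (nth None u ((i + j) %% Q)) (split (tnth v j)).1.
    by rewrite (cycE None) tnth_mktuple.
  by split=> cov j; have := cov j; rewrite E.
have [i0 [/baseE cov0 uniq0]] := u_up b.
pose e : 'I_x := inord (d - i0 %% x).
pose w := [tuple (split (tnth v (lift e l))).2 | l < d].
have [t [tw uniqt]] := nk_perfect q.-1 (rank i0) w.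
have QE : Q = Q %/ x * x by rewrite (divnK size_u).
have xi s i : (s * Q + i) %% x = i %% x by rewrite QE mulnA modnMDl.
have ranki s i : rank (s * Q + i) = rank i + s * q.-1.+1.
  by rewrite {1}QE mulnA rankD prednK ?q_gt0 // -mulnA [_ * d]mulnC addnC.
have Qi s i j : (s * Q + i + j) %% Q = (i + j) %% Q.
  by rewrite -addnA modnMDl.
have Psize : t * Q + i0 < size mult_word.
  rewrite size_mult_word; have := ltn_ord t; have := ltn_ord i0.
  rewrite -/Q -/d -/B => i0Q tB; apply: (@leq_trans (t.+1 * Q)).
    by rewrite mulSn addnC ltn_add2r.
  by rewrite mulnC leq_mul2l tB orbT.
exists (Ordinal Psize); split=> [|P' /covers_mult/mult_window[covP rankP]].
  apply/covers_mult/mult_window; split=> [j|l] /=; first by rewrite Qi.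
  by rewrite ranki xi tw tnth_mktuple.
apply/val_inj => /=.
have P'Q : P' %% Q < Q by rewrite ltn_mod u_gt0.
have Ei0 : i0 = Ordinal P'Q.
  by apply: uniq0; apply/baseE => j; rewrite /= modnDml.
have EP' : P' = P' %/ Q * Q + i0 :> nat by rewrite Ei0 -divn_eq.
have tB : P' %/ Q < B.
  by rewrite ltn_divLR ?u_gt0 // mulnC -size_mult_word.
rewrite EP'; congr (_ * _ + _); rewrite -[RHS]/(val (Ordinal tB)); congr val.
apply: uniqt => j; rewrite /= -ranki -EP' rankP tnth_mktuple.
by rewrite {1}EP' xi.
Qed.

Lemma mult_word_wild : None \in mult_word /\ exists c, Some c \in mult_word.
Proof.
have xQ : x <= Q by rewrite dvdn_leq ?u_gt0.
have xQB : x <= Q * B by rewrite (leq_trans xQ) // leq_pmulr // expn_gt0.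
have sym_mem i : i < x -> mult_sym i \in mult_word.
  by move=> ix; apply: map_f; rewrite mem_iota (leq_trans ix).
split.
  have := sym_mem d (ltnSn d); rewrite /mult_sym.
  have := u_wild xQ; rewrite !modn_small // eqxx.
  by case: nth.
have := sym_mem 0 isT; rewrite /mult_sym mod0n.
have := u_wild u_gt0; rewrite mod0n /=.
by case: nth => // b _; exists (glue (b, colour 0)).
Qed.

End AlphabetMultiplier.

(** * Two binary upcycles, checked by evaluation *)

Fixpoint bool_words (n : nat) : seq (seq bool) :=
  if n is n'.+1
  then [seq b :: w | b <- [:: true; false], w <- bool_words n'] else [:: [::]].

Lemma mem_bool_words w : w \in bool_words (size w).
Proof.
elim: w => // b w IHw; apply/allpairsP; exists (b, w).
by rewrite IHw; case: b.
Qed.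

Definition windows (x : nat) (u : seq (option bool)) : seq (seq (option bool)) :=
  [seq take x (drop i (u ++ u)) | i <- iota 0 (size u)].

Definition upcycle_check (x : nat) (u : seq (option bool)) : bool :=
  let ws := windows x u in
  all (fun w => count (fun win => all2 (@fits bool) win w) ws == 1)
      (bool_words x).

Lemma upcycleP x u : x <= size u -> upcycle_check x u -> upcycle x u.
Proof.
move=> xu /allP chk v.
have vx : tval v \in bool_words x.
  by rewrite -[X in bool_words X](size_tuple v) mem_bool_words.
have {chk vx}/eqP := chk v vx; rewrite count_map => cnt.
pose a i := all2 (@fits bool) (take x (drop i (u ++ u))) v.
have szw i : i < size u -> size (take x (drop i (u ++ u))) = x.
  by move=> iu; rewrite size_takel // size_drop size_cat; lia.
have aP (i : 'I_(size u)) : reflect (covers i v) (a i).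
  have nthE (j : 'I_x) : nth None (take x (drop i (u ++ u))) j = cyc i j.
    have iu := ltn_ord i; have ju := leq_trans (ltn_ord j) xu.
    rewrite (cycE None) nth_take // nth_drop nth_cat; case: ltnP => iju.
      by rewrite modn_small.
    by rewrite -{2}(subnK iju) modnDr modn_small //; lia.
  rewrite /a all2E szw // size_tuple eqxx /=.
  apply: (iffP (all_nthP (None, false)));
    rewrite size_zip szw // size_tuple minnn => cov j.
    have := cov j (ltn_ord j).
    by rewrite nth_zip ?szw ?size_tuple //= nthE -tnth_nth.
  move=> jx; rewrite nth_zip ?szw ?size_tuple //=.
  by have := cov (Ordinal jx); rewrite (tnth_nth false) -nthE.
have : size (filter a (iota 0 (size u))) = 1 by rewrite size_filter.
case E: filter => [|i [|//]] // _.
have memE j : (j == i) = a j && (j < size u).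
  by rewrite -(mem_seq1 j) -E mem_filter mem_iota.
have /andP[ai iu] : a i && (i < size u) by rewrite -memE.
exists (Ordinal iu); split=> [|j /aP aj]; first exact/aP.
by apply/val_inj/esym/eqP; rewrite memE aj ltn_ord.
Qed.

Definition read_bits : seq nat -> seq (option bool) :=
  map (fun c => if c is 0 then Some false else if c is 1 then Some true else None).

(** The blocks without their wildcards, 001 and 110, form a coset of the Hamming
    code of length 3. *)
Definition base4 : seq (option bool) := read_bits [:: 0; 0; 1; 2;  1; 1; 0; 2].

(** Fourteen of the sixteen blocks, without their wildcards, lie in a coset of a
    Hamming code of length 7.  The whole coset can be arranged with all windows
    distinct, but only in a cycle of fourteen and a cycle of two blocks; replacing
    the latter two by 1001100 and 0110011, found by search, gives one cycle. *)
Definition base8 : seq (option bool) := read_bits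
 [:: 0; 0; 0; 0; 0; 1; 1; 2;
     1; 0; 1; 0; 0; 1; 0; 2;
     1; 1; 1; 0; 0; 0; 1; 2;
     0; 1; 1; 0; 1; 1; 1; 2;
     0; 1; 1; 1; 0; 1; 0; 2;
     0; 1; 0; 0; 0; 0; 0; 2;
     0; 0; 1; 0; 1; 0; 0; 2;
     1; 1; 1; 1; 1; 0; 0; 2;
     0; 1; 1; 0; 0; 1; 1; 2;
     1; 0; 0; 1; 1; 0; 0; 2;
     0; 1; 0; 1; 1; 0; 1; 2;
     0; 0; 0; 1; 1; 1; 0; 2;
     1; 0; 0; 1; 0; 0; 0; 2;
     1; 0; 0; 0; 1; 0; 1; 2;
     1; 0; 1; 1; 1; 1; 1; 2;
     1; 1; 0; 1; 0; 1; 1; 2].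

Lemma upcycle_base4 : upcycle 4 base4.
Proof. by apply: upcycleP; vm_compute. Qed.

Lemma upcycle_base8 : upcycle 8 base8.
Proof. by apply: upcycleP; vm_compute. Qed.

(** * The torus m(u,s) *)

Section Torus.

Variables (A : finType) (u : seq (option A)).
Notation n := (size u).
Implicit Types s : seq 'I_n.

Definition prefix_sum s (i : nat) := \sum_(c <- take i.+1 s) (c : nat).

Lemma nth_rot1 (B : Type) (b0 : B) (t : seq B) j : j < size t ->
  nth b0 (rot 1 t) j = nth b0 t (j.+1 %% size t).
Proof.
case: t => // b t; rewrite rot1_cons nth_rcons [size (b :: t)]/= ltnS => jt.
have [{}jt|tj] := ltnP j (size t); first by rewrite modn_small.
have -> : j = size t by apply/eqP; rewrite eqn_leq jt.
by rewrite eqxx modnn.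
Qed.

Lemma size_iter_rot1 (B : Type) (t : seq B) k : size (iter k (rot 1) t) = size t.
Proof. by elim: k => //= k IHk; rewrite size_rot. Qed.

Lemma nth_iter_rot1 (B : Type) (b0 : B) (t : seq B) k j : j < size t ->
  nth b0 (iter k (rot 1) t) j = nth b0 t ((k + j) %% size t).
Proof.
elim: k j => [|k IHk] j jt; first by rewrite modn_small.
rewrite iterS nth_rot1 size_iter_rot1 // IHk ?ltn_mod ?(leq_trans _ jt) //.
by rewrite modnDmr addnS.
Qed.

Lemma m_torusE s (i : 'I_(size s)) (j : 'I_n) :
  m_torus s i j = nth None u ((prefix_sum s i + j) %% n).
Proof.
have F (t : seq 'I_n) v : size v = n ->
    nth None (foldl (fun phi (k : 'I_n) => iter k (rot 1) phi) v t) j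
     = nth None v ((\sum_(c <- t) c + j) %% n).
  elim: t v => [|c t IHt] v vn /=; first by rewrite big_nil add0n modn_small.
  rewrite IHt ?size_iter_rot1 // nth_iter_rot1 vn ?ltn_mod ?(leq_trans _ (ltn_ord j)) //.
  by rewrite big_cons modnDmr addnA.
by rewrite mxE /rotation_rows nth_scanl // F.
Qed.

(** Around the end of s this needs the total to vanish modulo n. *)
Lemma prefix_sumS s t : 0 < size s -> n %| \sum_(c <- s) (c : nat) ->
  prefix_sum s (t.+1 %% size s) =
    prefix_sum s (t %% size s) + nth 0 (map val s) (t.+1 %% size s) %[mod n].
Proof.
move=> s_gt0 n_sum; rewrite -addn1 -modnDml addn1.
have take1 i : i < size s ->
    prefix_sum s i = \sum_(c <- take i s) c + nth 0 (map val s) i.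
  case: s i {s_gt0 n_sum} => // c0 s i si.
  rewrite /prefix_sum (take_nth c0) //.
  by rewrite -cats1 big_cat big_seq1 (nth_map c0).
have := ltn_pmod t s_gt0; rewrite leq_eqVlt => /predU1P[Et|ts].
  rewrite Et modnn take1 // take0 big_nil add0n.
  rewrite /prefix_sum Et take_size -modnDml.
  by move/eqP: n_sum => ->.
by rewrite (modn_small ts) take1.
Qed.

Section Covering.

Variables (x y : nat) (s : seq 'I_n).
Hypotheses (u_up : upcycle x u) (s_db : debruijn y s).
Hypothesis n_sum : n %| \sum_(c <- s) (c : nat).

(** The rows of P are covered by u at unique positions p; their differences are
    the word w that must be read in s after row r. *)
Lemma uptorus_m_torus : uptorus y.+1 x (m_torus s).
Proof.
move=> P; pose v i := [tuple P i j | j < x].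
have [p pP] : exists p : 'I_y.+1 -> 'I_n,
    forall i, unique (fun q : 'I_n => covers q (v i)) (p i).
  apply: (fin_all_exists (P := fun i => unique (fun q : 'I_n => covers q (v i)))).
  by move=> i; apply: u_up.
have n_gt0 : 0 < n by apply: leq_trans (ltn_ord (p ord0)).
have [r0 _] := s_db [tuple Ordinal n_gt0 | _ < y].
have s_gt0 : 0 < size s by apply: leq_trans (ltn_ord r0).
have covE (r : 'I_(size s)) (c : 'I_n) : @torus_covers A y.+1 x (m_torus s) r c P <->
    forall i : 'I_y.+1, prefix_sum s ((r + i) %% size s) + c = p i %[mod n].
  have entry (i : 'I_y.+1) (j : 'I_x) : m_torus s (cshift r i) (cshift c j) =
      nth None u ((prefix_sum s ((r + i) %% size s) + c + j) %% n).
    by rewrite m_torusE !cshiftE modnDmr addnA.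
  have posE (i : 'I_y.+1) a :
      (forall j : 'I_x, fits (nth None u ((a + j) %% n)) (P i j)) <-> a = p i %[mod n].
    have an : a %% n < n by rewrite ltn_mod.
    have cE (q : 'I_n) : covers q (v i) <->
        forall j : 'I_x, fits (nth None u ((q + j) %% n)) (P i j).
      by split=> cq j; have := cq j; rewrite (cycE None) tnth_mktuple.
    have [cov uniq] := pP i; rewrite [p i %% n]modn_small //; split=> [ca|ai].
      suff -> : p i = Ordinal an by [].
      by apply: uniq; apply/cE => j /=; rewrite modnDml.
    by move=> j; rewrite -modnDml ai; move: j; apply/cE.
  split=> [cov i|Ep i j]; first by apply/posE => j; rewrite -entry; apply: cov.
  by rewrite entry; move: j; apply/posE/Ep.
pose w := [tuple (Ordinal (ltn_pmod
  (p (lift ord0 l) + (n - p (widen_ord (leqnSn y) l))) n_gt0)) | l < y].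
have [i0 [i0w uniq_i0]] := s_db w.
have wE (r : 'I_(size s)) : (forall l : 'I_y, cyc (ordS r) l = tnth w l) <->
   forall l : 'I_y, nth 0 (map val s) ((r + l).+1 %% size s) + p (widen_ord (leqnSn y) l)
     = p (lift ord0 l) %[mod n].
  have letter (l : 'I_y) : cyc (ordS r) l = tnth w l <->
     nth 0 (map val s) ((r + l).+1 %% size s) + p (widen_ord (leqnSn y) l)
       = p (lift ord0 l) %[mod n].
    set a := p (widen_ord _ l); set b := p (lift ord0 l).
    have E : cyc (ordS r) l = tnth w l <->
        nth 0 (map val s) ((r + l).+1 %% size s) = (b + (n - a)) %% n.
      rewrite (cycE (Ordinal n_gt0)) tnth_mktuple /= modnDml addSn.
      rewrite (nth_map (Ordinal n_gt0)) ?ltn_mod //.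
      by split=> [->|El] //; apply/val_inj.
    have an := ltnW (ltn_ord a).
    have lt_n : nth 0 (map val s) ((r + l).+1 %% size s) < n.
      by rewrite (nth_map (Ordinal n_gt0)) ?ltn_mod ?ltn_ord.
    apply: (iff_trans E); split=> [->|{}E].
      by rewrite modnDml -addnA subnK // modnDr.
    rewrite -[LHS](modn_small lt_n); apply/eqP.
    by rewrite -(eqn_modDr a) E -addnA subnK // modnDr.
  by split=> H l; have := H l; move/letter.
have psumE (r : 'I_(size s)) (c : 'I_n) : 
   (forall i : 'I_y.+1, prefix_sum s ((r + i) %% size s) + c = p i %[mod n]) <->
   prefix_sum s r + c = p ord0 %[mod n] /\ forall l : 'I_y, cyc (ordS r) l = tnth w l.
  have stepE (l : 'I_y) : prefix_sum s ((r + l.+1) %% size s) + c =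
      nth 0 (map val s) ((r + l).+1 %% size s)
        + (prefix_sum s ((r + l) %% size s) + c) %[mod n].
    rewrite addnS -[LHS]modnDml prefix_sumS // modnDml.
    by rewrite [prefix_sum _ _ + nth _ _ _]addnC addnA.
  split=> [Ep|[E0 /wE Es] [i iy]].
    split; first by have := Ep ord0; rewrite addn0 (modn_small (ltn_ord r)).
    apply/wE => l; rewrite -(Ep (lift ord0 l)) /= stepE.
    by rewrite -modnDmr -(Ep (widen_ord (leqnSn y) l)) modnDmr.
  elim: i iy => [|i IHi] iy.
    rewrite /= addn0 (modn_small (ltn_ord r)) E0; congr (_ %% _).
    by congr (val (p _)); apply/val_inj.
  have iy' : i < y by [].
  have := Es (Ordinal iy'); rewrite /= => Ei.
  rewrite /= (stepE (Ordinal iy')) /= -modnDmr (IHi (ltnW iy)) modnDmr.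
  rewrite (_ : Ordinal iy = lift ord0 (Ordinal iy')); last exact/val_inj.
  by rewrite -Ei; congr ((_ + val (p _)) %% _); apply/val_inj.
pose r := ord_pred i0; have rE : ordS r = i0 by rewrite /r ord_predK.
have c_lt : (p ord0 + (n - prefix_sum s r %% n)) %% n < n by rewrite ltn_mod.
have c_sum : p ord0 + (n - prefix_sum s r %% n) + prefix_sum s r = p ord0 %[mod n].
  by rewrite -modnDmr -addnA subnK ?modnDr // ltnW // ltn_mod.
exists (r, Ordinal c_lt); split=> [|[r' c']] /=.
  apply/covE/psumE; rewrite rE; split=> //=.
  by rewrite modnDmr addnC c_sum.
move=> /covE/psumE[Ec Er].
have {Er} Er : r' = r by rewrite /r (uniq_i0 _ Er) ordSK.
congr pair => //; apply/val_inj => /=; rewrite -[RHS](modn_small (ltn_ord c')).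
rewrite Er in Ec.
by apply/eqP; rewrite -(eqn_modDl (prefix_sum s r)) Ec addnC c_sum.
Qed.

End Covering.

(** Rows that correspond under the translation are equal rotations of u.  As u
    covers no word twice, equal rotations are by the same amount.  So the prefix
    sums agree up to the constant c, and the letters are their differences. *)
Lemma same_torus_rotation x s s' (b : A) : upcycle x u ->
    0 < size s -> n %| \sum_(c <- s) (c : nat) -> n %| \sum_(c <- s') (c : nat) ->
    same_torus (m_torus s) (m_torus s') ->
  exists r, forall i,
    nth 0 (map val s) (i %% size s) = nth 0 (map val s') ((i + r) %% size s).
Proof.
move=> u_up s_gt0 n_sum n_sum' [[e1 e2] [r [c eqT]]]; exists r.
simpl in e1, e2.
have s'_gt0 : 0 < size s' by rewrite -e1.
have [i0 _] := u_up [tuple b | _ < x].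
have n_gt0 : 0 < n by apply: leq_trans (ltn_ord i0).
have sumE t : prefix_sum s (t %% size s)
    = prefix_sum s' ((t + r) %% size s') + c %[mod n].
  have ts : t %% size s' < size s' by rewrite ltn_mod.
  set a := prefix_sum s _; set a' := prefix_sum s' _.
  have agree j : j < n ->
      nth None u ((a + j) %% n) = nth None u ((a' + c + j) %% n).
    move=> jn; have := eqT (Ordinal ts) (Ordinal jn).
    rewrite castmxE !m_torusE /= !cshiftE /= modnDmr modnDml addnA.
    by rewrite /a /a' e1 addnAC.
  (* A word covered at a, wildcards being filled with b. *)
  pose v := [tuple odflt b (nth None u ((a + j) %% n)) | j < x].
  have [i [_ uniq]] := u_up v.
  have pos z :
      (forall j, nth None u ((z + j) %% n) = nth None u ((a + j) %% n)) ->
      i = z %% n :> nat.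
    have zn : z %% n < n by rewrite ltn_mod.
    move=> Ez; rewrite -[RHS]/(val (Ordinal zn)); congr val; apply: uniq => j.
    rewrite (cycE None) tnth_mktuple /= modnDml Ez /fits.
    by case: nth => //= ?; rewrite eqxx.
  rewrite -(pos a) // (pos (a' + c)) // => j.
  by have := agree (j %% n); rewrite !modnDmr ltn_mod => ->.
have step t : nth 0 (map val s) (t.+1 %% size s)
    = nth 0 (map val s') ((t.+1 + r) %% size s').
  have lt_nth (z : seq 'I_n) i : nth 0 (map val z) i < n.
    have [iz|zi] := ltnP i (size z); last by rewrite nth_default ?size_map.
    have : nth 0 (map val z) i \in map val z by rewrite mem_nth ?size_map.
    by case/mapP=> o _ ->; apply: ltn_ord.
  rewrite -[LHS](modn_small (lt_nth _ _)) -[RHS](modn_small (lt_nth _ _)).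
  apply/eqP; rewrite -(eqn_modDl (prefix_sum s (t %% size s))) -prefix_sumS // sumE.
  rewrite addSn -modnDml prefix_sumS // modnDml -[X in _ == X]modnDml sumE modnDml.
  by rewrite addnAC.
move=> i; have := step (i + (size s).-1).
by rewrite -e1 -addnS prednK // addnAC !modnDr.
Qed.

End Torus.

(** * The family of tori *)

(** No two of these words are rotations of each other, since the first letters of
    the tours are fixed in [db_stacks]. *)
Definition db_words (n k : nat) : seq (seq 'I_n) :=
  if n is m.+1 then [seq db_word p | p <- enum (db_stacks m k)] else [::].

Lemma size_db_words n k : 0 < n ->
  size (db_words n k) * n ^ k.+2 = n`! ^ (n ^ k.+1).
Proof. by case: n => // m _; rewrite size_map -cardE card_db_stacks. Qed.

Lemma db_wordsP n k s : s \in db_words n k ->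
  [/\ size s = n ^ k.+2, debruijn k.+2 s & n %| \sum_(c <- s) (c : nat)].
Proof.
case: n s => // m s /mapP[p]; rewrite mem_enum inE => /andP[_ pT] ->.
by split; [rewrite size_mkseq | apply: debruijn_db_word | apply: db_word_sum].
Qed.

Lemma db_words_rotation n k s s' r : s \in db_words n k -> s' \in db_words n k ->
    (forall i, nth 0 (map val s) (i %% size s)
             = nth 0 (map val s') ((i + r) %% size s)) ->
  s = s'.
Proof.
case: n s s' => // m s s' /mapP[p + ->] /mapP[p' + ->]; rewrite !mem_enum => pS p'S.
have nthE (q : {ffun k.+1.-tuple 'I_m.+1 -> {perm 'I_m.+1}}) j :
    nth 0 (map val (db_word q)) (j %% m.+1 ^ k.+2)
    = nth ord0 (db_word q) (j %% m.+1 ^ k.+2).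
  by rewrite (nth_map ord0) ?size_mkseq ?ltn_mod ?expn_gt0.
rewrite size_mkseq => Es; congr db_word.
apply: (db_word_inj (r := r) pS p'S) => i.
by apply/val_inj; rewrite /= -!nthE Es.
Qed.

Lemma db_words_uniq n k : uniq (db_words n k).
Proof.
case: n => // m; rewrite map_inj_in_uniq ?enum_uniq // => p p'.
rewrite !mem_enum => pS p'S E; apply: (db_word_inj (r := 0) pS p'S) => i.
by rewrite E addn0.
Qed.

Lemma even_upcycle a x : ~~ odd a -> 2 <= a -> x = 4 \/ x = 8 ->
  exists u : seq (option 'I_a),
    [/\ size u = a ^ (x - 1), upcycle x u, None \in u & exists c, Some c \in u].
Proof.
move=> a_even a2.
have [m Ea] : exists m, a = 2 * m.+1.
  by exists a./2.-1; rewrite prednK ?half_gt0 // mul2n even_halfK.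
have cardE : #|{: bool * 'I_m.+1}| = a by rewrite card_prod card_bool card_ord.
pose glue z := cast_ord cardE (enum_rank z).
pose split c := enum_val (cast_ord (esym cardE) c).
have glueK : cancel glue split by move=> z; rewrite /split cast_ordK enum_rankK.
have splitK : cancel split glue by move=> c; rewrite /glue enum_valK cast_ordKV.
have mult k (b : seq (option bool)) :
    upcycle k.+3 b -> size b = 2 ^ k.+2 -> k.+3 %| size b ->
    all (fun i => (nth None b i == None) == (i %% k.+3 == k.+2)) (iota 0 (size b)) ->
    exists u : seq (option 'I_a),
      [/\ size u = a ^ k.+2, upcycle k.+3 u, None \in u & exists c, Some c \in u].
  move=> b_up b_size xb /allP b_wild.
  have wild i : i < size b -> (nth None b i == None) = (i %% k.+3 == k.+2).
    by move=> ib; have := b_wild i; rewrite mem_iota ib => /(_ isT)/eqP.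
  exists (mult_word k glue b).
  have [uN uS] := mult_word_wild glue b_up xb wild.
  split=> //; last exact: (upcycle_mult glueK splitK b_up xb wild).
  by rewrite size_mult_word b_size Ea expnMn.
case=> ->; first by apply: (mult 1 base4 upcycle_base4).
by apply: (mult 5 base8 upcycle_base8).
Qed.

Section TorusFamily.

Variables (A : finType) (x k : nat) (u : seq (option A)) (c : A).
Hypotheses (x1 : 1 < x) (u_up : upcycle x u) (uN : None \in u) (uc : Some c \in u).

Lemma db_torus s : s \in db_words (size u) k ->
  nontrivial_uptorus k.+3 x (m_torus s) /\ of_form_m x k.+2 (m_torus s).
Proof.
move=> /db_wordsP[s_size s_db s_sum]; split; last by exists u, s.
split; first exact: uptorus_m_torus.
have n_gt0 : 0 < size u by case: u uN.
have s_gt0 : 0 < size s by rewrite s_size expn_gt0 n_gt0.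
have entry o : o \in u -> exists j, m_torus s (Ordinal s_gt0) j = o.
  move=> ou; set t := prefix_sum s 0.
  exists (Ordinal (ltn_pmod (index o u + (size u - t %% size u)) n_gt0)).
  rewrite m_torusE /= modnDmr addnC -modnDmr -addnA subnK 1?ltnW ?ltn_mod //.
  by rewrite modnDr modn_small ?index_mem // nth_index.
case=> [noN | allN | // | x_1]; last by move: x1; rewrite x_1.
  by have [j Ej] := entry _ uN; case: (noN _ _ Ej).
by have [j] := entry _ uc; rewrite allN.
Qed.

Lemma db_torus_inj s s' : s \in db_words (size u) k -> s' \in db_words (size u) k ->
  same_torus (m_torus s) (m_torus s') -> s = s'.
Proof.
move=> sS s'S; have [s_size _ s_sum] := db_wordsP sS; have [_ _ s'_sum] := db_wordsP s'S.
have n_gt0 : 0 < size u by case: u uN.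
have s_gt0 : 0 < size s by rewrite s_size expn_gt0 n_gt0.
case/(same_torus_rotation c u_up s_gt0 s_sum s'_sum) => r.
exact: (db_words_rotation sS s'S).
Qed.

End TorusFamily.

Theorem corollary6p8 :
  (exists (a : nat -> nat) (T : forall n : nat, ptorus 'I_(a n)),
      (forall n : nat,
          [/\ 0 < a n,
              exists x y : nat, [/\ 0 < x, 2 <= y & of_form_m x y (T n)]
            & exists w l : nat, nontrivial_uptorus w l (T n)]) /\
      (forall m n : nat,
          same_torus (relabel (@nat_of_ord (a m)) (T m))
                     (relabel (@nat_of_ord (a n)) (T n)) -> m = n)) /\
  (forall a y x : nat,
      ~~ odd a -> 2 <= a -> 2 <= y -> (x = 4 \/ x = 8) ->
      exists (N : nat) (T : 'I_N -> ptorus 'I_a),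
        [/\ (((a ^ (x - 1))`! ^ (a ^ ((x - 1) * (y - 1))))%N%:R
               / (a ^ ((x - 1) * y))%N%:R <= N%:R :> rat)%R,
            forall i : 'I_N,
              nontrivial_uptorus (y + 1) x (T i) /\ of_form_m x y (T i)
          & forall i j : 'I_N, same_torus (T i) (T j) -> i = j]).
Proof.
split.
  (* Binary tori from words of length 4; the orders k.+2 are told apart by the
     number of rows. *)
  have [u [u_size u_up uN [c uc]]] :=
    even_upcycle (a := 2) isT isT (or_introl (erefl 4)).
  have n_gt0 : 0 < size u by rewrite u_size.
  pose word k := head [::] (db_words (size u) k).
  have wordP k : word k \in db_words (size u) k.
    have : 0 < size (db_words (size u) k).
      rewrite -(@ltn_pmul2r (size u ^ k.+2)) ?expn_gt0 ?n_gt0 // mul0n.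
      by rewrite size_db_words // expn_gt0 fact_gt0.
    by rewrite /word; case: db_words => //= s ss _; rewrite mem_head.
  exists (fun=> 2), (fun k => m_torus (word k)); split=> [k|k k' [[e _] _]].
    have [T_nontriv T_form] := db_torus (x := 4) isT u_up uN uc (wordP k).
    by split; [ | exists 4, k.+2 | exists k.+3, 4].
  move: e => /=; have [-> _ _] := db_wordsP (wordP k).
  have [-> _ _] := db_wordsP (wordP k').
  have n_gt1 : 1 < size u by rewrite u_size.
  by move=> /(expnI n_gt1)[].
move=> a [|[|k]] x // a_even a2 _ x48.
have [u [u_size u_up uN [c uc]]] := even_upcycle a_even a2 x48.
have n_gt0 : 0 < size u by case: u uN {u_size u_up uc}.
have x1 : 1 < x by case: x48 => ->.
pose ws := db_words (size u) k.
have wsP (i : 'I_(size ws)) : nth [::] ws i \in ws by rewrite mem_nth.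
exists (size ws), (fun i : 'I_(size ws) => m_torus (nth [::] ws i)); split=> [|i|i j].
  have an : 0 < a ^ ((x - 1) * k.+2) by rewrite expn_gt0 (leq_trans _ a2).
  by rewrite ler_pdivrMr ?ltr0n // -natrM ler_nat !expnM -u_size size_db_words.
  by rewrite addn1; exact: (db_torus x1 u_up uN uc (wsP i)).
move=> /(db_torus_inj c u_up uN (wsP i) (wsP j))/eqP.
by rewrite nth_uniq ?db_words_uniq // => /eqP/val_inj.
Qed.
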